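(* Let $\mathfrak M=\{M^\lambda:\lambda\in\Lambda\}$ be a weight matrix and $p,q,r\ge1$. (1) If $\mathfrak M$ satisfies $(\mathfrak M_{(FdB)})$, then the composition map $\mathrm{comp}^{(\mathfrak M)}:\mathcal E^{(\mathfrak M)}(\mathbb R^p,\mathbb R^q)\times\mathcal E^{(\mathfrak M)}(\mathbb R^q,\mathbb R^r)\to\mathcal E^{(\mathfrak M)}(\mathbb R^p,\mathbb R^r)$, $(g,f)\mapsto f\circ g$, is continuous. (2) If $\mathfrak M$ satisfies $(\mathfrak M_{\{FdB\}})$, then for each $f\in\mathcal E^{\{\mathfrak M\}}(\mathbb R^q,\mathbb R^r)$ the map $\mathcal E^{\{\mathfrak M\}}(\mathbb R^p,\mathbb R^q)\to\mathcal E^{\{\mathfrak M\}}(\mathbb R^p,\mathbb R^r)$, $g\mapsto f\circ g$, is continuous, and the composition map $\mathrm{comp}^{\{\mathfrak M\}}:\mathcal E^{\{\mathfrak M\}}(\mathbb R^p,\mathbb R^q)\times\mathcal E^{\{\mathfrak M\}}(\mathbb R^q,\mathbb R^r)\to\mathcal E^{\{\mathfrak M\}}(\mathbb R^p,\mathbb R^r)$, $(g,f)\mapsto f\circ g$, is sequentially continuous.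
   Context: A weight matrix is a family $\mathfrak M=\{M^\lambda\in\mathbb R_{>0}^{\mathbb N}:\lambda\in\Lambda\}$, $\Lambda$ an ordered subset of $\mathbb R$, with each $(k!M^\lambda_k)_k$ log-convex, $M^\lambda_0=1$, $(k!M^\lambda_k)^{1/k}\to\infty$, and $M^\lambda\le M^\mu$ for $\lambda\le\mu$. For $M\in\mathbb R_{>0}^{\mathbb N}$, compact $K\subseteq\mathbb R^n$, $\rho>0$: $\|f\|^M_{K,\rho}:=\sup\{\|f^{(k)}(x)\|/(k!\rho^kM_k):x\in K,k\in\mathbb N\}$, $\mathcal E^M_\rho(K,\mathbb R^m)$ the Banach space of smooth maps on $K$ with finite norm, $\mathcal E^{\{M\}}(K,\mathbb R^m)=\varinjlim_m\mathcal E^M_m(K,\mathbb R^m)$; $\mathcal E^{(M)}(U,\mathbb R^m)$ is the Fréchet space of smooth $f$ on open $U$ with all $\|f\|^M_{K,\rho}<\infty$ ($K\subseteq U$ compact, $\rho>0$). Topologized spaces: $\mathcal E^{(\mathfrak M)}(U,\mathbb R^m):=\varprojlim_\lambda\mathcal E^{(M^\lambda)}(U,\mathbb R^m)$ and $\mathcal E^{\{\mathfrak M\}}(U,\mathbb R^m):=\varprojlim_{K\subseteq U}\varinjlim_\lambda\mathcal E^{\{M^\lambda\}}(K,\mathbb R^m)$ (functions whose restrictions to every compact $K$ lie in some $\mathcal E^{\{M^\lambda\}}(K,\mathbb R^m)$); products carry the product topology. $M^\circ_k:=\max\{M_jM_{\alpha_1}\cdots M_{\alpha_j}:\alpha_i\ge1,\sum\alpha_i=k\}$,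 $M^\circ_0=1$; $M\preceq N$ iff $\exists C,\rho>0\ \forall k:M_k\le C\rho^kN_k$. $(\mathfrak M_{(FdB)})$: $\forall\lambda\exists\mu:(M^\mu)^\circ\preceq M^\lambda$; $(\mathfrak M_{\{FdB\}})$: $\forall\lambda\exists\mu:(M^\lambda)^\circ\preceq M^\mu$. *)

(* Defs.v *)
From HB Require Import structures.
From mathcomp Require Import all_boot all_order all_algebra.
From mathcomp Require Import all_classical all_reals all_analysis.
Unset Printing Implicit Defensive.
Import Order.TTheory GRing.Theory Num.Theory.
Import numFieldNormedType.Exports.
Local Open Scope classical_set_scope.
Local Open Scope ring_scope.

Section Defs.
Variable R : realType.

Definition vec (n : nat) := 'rV[R]_n.

Definition weight_matrix (Lam : set R) (M : R -> nat -> R) : Prop :=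
  (forall l, Lam l ->
     [/\ M l 0%N = 1,
         (forall k, 0 < M l k),
         (forall k, (0 < k)%N ->
            ((k`!)%:R * M l k) ^+ 2
              <= ((k.-1)`!%:R * M l k.-1) * ((k.+1)`!%:R * M l k.+1)) &
         (forall A : R, exists N : nat, forall k, (N <= k)%N -> (0 < k)%N ->
            A < ((k`!)%:R * M l k) `^ (k%:R)^-1)]) /\
  (forall l m, Lam l -> Lam m -> l <= m -> forall k, M l k <= M m k).

Definition circ (M : nat -> R) (k : nat) : R :=
  if k == 0%N then 1 else
  \big[Num.max/0]_(j < k.+1)
    \big[Num.max/0]_(a : {ffun 'I_j -> 'I_k.+1} |
         [forall i, (0 < a i)%N] && ((\sum_(i < j) (a i : nat))%N == k))
       (M j * \prod_(i < j) M (a i)).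

Definition wpreceq (M N : nat -> R) : Prop :=
  exists C rho : R, 0 < C /\ 0 < rho /\ forall k, M k <= C * rho ^+ k * N k.

Definition FdB_beurling (Lam : set R) (M : R -> nat -> R) : Prop :=
  forall l, Lam l -> exists m, Lam m /\ wpreceq (circ (M m)) (M l).

Definition FdB_roumieu (Lam : set R) (M : R -> nat -> R) : Prop :=
  forall l, Lam l -> exists m, Lam m /\ wpreceq (circ (M l)) (M m).

(* iterated directional derivative: iterD f [:: v1; ...; vk] x = f^(k)(x)(v1,...,vk) *)
Fixpoint iterD {p q : nat} (f : vec p -> vec q) (vs : seq (vec p)) : vec p -> vec q :=
  match vs with
  | [::] => f
  | v :: vs' => fun x => 'D_v (iterD f vs') x
  end.

Definition smooth {p q : nat} (f : vec p -> vec q) : Prop :=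
  forall vs : seq (vec p),
    continuous (iterD f vs) /\ forall x v, derivable (iterD f vs) x v.

(* ||f||^M_{K,rho} = sup { ||f^(k)(x)|| / (k! rho^k M_k) : x in K, k in N },
   with ||f^(k)(x)|| the operator norm (sup over v_i with ||v_i|| <= 1) *)
Definition wnorm {p q : nat} (M : nat -> R) (K : set (vec p)) (rho : R)
    (f : vec p -> vec q) : \bar R :=
  ereal_sup [set y : \bar R | exists x (vs : seq (vec p)),
     [/\ K x, all (fun v => `|v| <= 1) vs &
         y = (`|iterD f vs x| / ((size vs)`!%:R * rho ^+ size vs * M (size vs)))%:E]].

Definition fsub {p q : nat} (f g : vec p -> vec q) : vec p -> vec q :=
  fun x => f x - g x.

Definition EB (Lam : set R) (M : R -> nat -> R) (p q : nat) : set (vec p -> vec q) :=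
  [set f | smooth f /\ forall l (K : set (vec p)) (rho : R),
     Lam l -> compact K -> 0 < rho -> (wnorm (M l) K rho f < +oo)%E].

Definition EB_nbhs (Lam : set R) (M : R -> nat -> R) (p q : nat)
    (g : vec p -> vec q) (N : set (vec p -> vec q)) : Prop :=
  exists (n : nat) (ls : 'I_n -> R) (Ks : 'I_n -> set (vec p)) (rhos : 'I_n -> R)
         (eps : R),
    [/\ forall i, Lam (ls i), forall i, compact (Ks i), forall i, 0 < rhos i,
        0 < eps &
        forall h, EB Lam M p q h ->
          (forall i, (wnorm (M (ls i)) (Ks i) (rhos i) (fsub h g) < eps%:E)%E) ->
          N h].

(* the (union) space  ind_{l,m} E^{M^l}_m(K) , represented by smooth functions on R^p *)
Definition FK (Lam : set R) (M : R -> nat -> R) (p q : nat) (K : set (vec p)) :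
    set (vec p -> vec q) :=
  [set f | smooth f /\ exists l (m : nat),
     Lam l /\ (wnorm (M l) K m.+1%:R f < +oo)%E].

(* functions with all derivatives vanishing on K (zero as elements of E(K)) *)
Definition nullK {p q : nat} (K : set (vec p)) (f : vec p -> vec q) : Prop :=
  forall vs x, K x -> iterD f vs x = 0.

Definition absconvex {p q : nat} (A : set (vec p -> vec q)) : Prop :=
  forall a b, A a -> A b -> forall s t : R, `|s| + `|t| <= 1 ->
    A (fun x => s *: a x + t *: b x).

(* W is a 0-neighbourhood for the locally convex inductive limit topology of
   ind_l ind_m E^{M^l}_m(K) (pulled back to functions on R^p) *)
Definition FK_nbhs0 (Lam : set R) (M : R -> nat -> R) (p q : nat)
    (K : set (vec p)) (W : set (vec p -> vec q)) : Prop :=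
  exists A : set (vec p -> vec q),
    [/\ A `<=` FK Lam M p q K, absconvex A,
        (forall l (m : nat), Lam l -> exists eps : R, 0 < eps /\
            forall h, smooth h -> (wnorm (M l) K m.+1%:R h < eps%:E)%E -> A h) &
        forall a h, A a -> smooth h -> nullK K (fsub h a) -> W h].

Definition ER (Lam : set R) (M : R -> nat -> R) (p q : nat) : set (vec p -> vec q) :=
  [set f | smooth f /\ forall K : set (vec p), compact K -> FK Lam M p q K f].

(* projective limit over compact K: N is a neighbourhood of g iff it contains the
   trace on the space of a finite intersection of translates g + W_i *)
Definition ER_nbhs (Lam : set R) (M : R -> nat -> R) (p q : nat)
    (g : vec p -> vec q) (N : set (vec p -> vec q)) : Prop :=
  exists (n : nat) (Ks : 'I_n -> set (vec p)) (Ws : 'I_n -> set (vec p -> vec q)),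
    [/\ forall i, compact (Ks i), forall i, FK_nbhs0 Lam M p q (Ks i) (Ws i) &
        forall h, ER Lam M p q h -> (forall i, Ws i (fsub h g)) -> N h].

End Defs.
Arguments weight_matrix {R}.
Arguments circ {R}.
Arguments wpreceq {R}.
Arguments FdB_beurling {R}.
Arguments FdB_roumieu {R}.
Arguments EB {R}.
Arguments EB_nbhs {R}.
Arguments ER {R}.
Arguments ER_nbhs {R}.
Arguments FK {R}.
Arguments FK_nbhs0 {R}.
Arguments wnorm {R}.
Arguments iterD {R}.
Arguments smooth {R}.
Arguments fsub {R}.
Arguments nullK {R}.
Arguments absconvex {R}.

(* Main.v *)
Require Import Defs.
From HB Require Import structures.
From mathcomp Require Import all_boot all_order all_algebra.
From mathcomp Require Import all_classical all_reals all_analysis.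
From mathcomp Require Import ring lra.
Import Order.TTheory GRing.Theory Num.Theory.
Import numFieldNormedType.Exports.
Set Implicit Arguments.
Unset Strict Implicit.
Local Open Scope classical_set_scope.
Local Open Scope ring_scope.

(** Faa di Bruno's formula writes a derivative of order k of f o g as a sum over
    the set partitions of k points. If the derivatives of f and g are bounded by
    F s^j j! M_j and G sig^a a! M_a, a partition with j blocks contributes at most
    F (s G)^j sig^k M^o_k times j! and the factorials of the block sizes, and the sum
    of these weights is at most k! (2 + s G)^k. The condition (FdB) then turns M^o
    into a weight of the matrix. For f o g' - f o g the same formula is telescoped;
    the only delicate term, f^(j)(g') - f^(j)(g), is made small by doubling the
    radius of f, which kills the high orders, and by the mean value theorem for
    the finitely many others.

    In the Beurling case the radii are chosen in the order sig, G, s. In the Roumieu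
    case Lambda has a cofinal sequence, so a neighbourhood of 0 contains a union of
    sums of balls, one for each step of the inductive limit; adding the summands of
    g' - g one by one, the n-th increment of f o g is absorbed by 2^-(n+1) A for the
    given absolutely convex A. For sequences, suitable weights that dominate all the
    steps show that a convergent sequence already converges in a single step. *)

(* [iterD] is shadowed by the lemma of ssrnat with the same name. *)
Local Notation iterD := (@Defs.iterD _ _ _).
Local Notation smooth := (@Defs.smooth _ _ _).
Local Notation fsub := (@Defs.fsub _ _ _).

(** * Directional derivatives *)

Section DirectionalDerivatives.
Variable R : realType.

Lemma norm_coord_le n (u : 'rV[R]_n) j : `|u ord0 j| <= `|u|.
Proof.
rewrite [leRHS]/Num.Def.normr/= mx_normrE.
exact: (le_bigmax _ (fun i : 'I_1 * 'I_n => `|u i.1 i.2|) (ord0, j)).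
Qed.

Lemma norm_row_le n (u : 'rV[R]_n) (e : R) : 0 <= e ->
  (forall j, `|u ord0 j| <= e) -> `|u| <= e.
Proof.
move=> e0 ue; rewrite [leLHS]/Num.Def.normr/= mx_normrE.
by apply: bigmax_le => // -[i j] _; rewrite /= (ord1 i).
Qed.

Lemma is_derive_line (V W : normedModType R) (h : V -> W) (x v : V) (t : R) :
  derivable h (x + t *: v) v ->
  is_derive t 1 (fun s : R => h (x + s *: v)) ('D_v h (x + t *: v)).
Proof.
move=> dh.
have E : (fun s : R => s^-1 *: (((fun s : R => h (x + s *: v)) \o shift t)
                          (s *: 1) - h (x + t *: v)))
   = (fun s => s^-1 *: ((h \o shift (x + t *: v)) (s *: v) - h (x + t *: v))).
  apply/funext => s /=; congr (_ *: (h _ - _)).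
  by rewrite [s *: 1]mulr1 scalerDl addrCA.
by split; [rewrite /derivable E | rewrite /derive E].
Qed.

Lemma is_derive_coord (V : normedModType R) n (h : V -> 'rV[R]_n) x v j d :
  is_derive x v h d -> is_derive x v (fun y => h y ord0 j) (d ord0 j).
Proof.
move=> [dh <-]; split; first exact: (derivable_mxP _ _ _).1.
by rewrite derive_mx // mxE.
Qed.

(** The norm of a row is the maximum over its coordinates, so the one-variable mean value theorem
    can be applied to each coordinate separately. The vector [a] will be a partial derivative in
    [C1_differentiable] and 0 in [derivative_modulus]. *)
Lemma mean_value_bound (V : normedModType R) n (h : V -> 'rV[R]_n)
    (x v : V) (a : 'rV[R]_n) (c e : R) :
  (forall y, derivable h y v) ->
  (forall t : R, `|t| <= `|c| -> `|'D_v h (x + t *: v) - a| <= e) ->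
  `|h (x + c *: v) - h x - c *: a| <= `|c| * e.
Proof.
move=> dh He.
have e0 : 0 <= e by apply: le_trans (He 0 _); rewrite ?normr0.
apply: norm_row_le => [|j]; first by rewrite mulr_ge0.
pose ph (s : R) : R := h (x + s *: v) ord0 j.
pose dph (s : R) : R := 'D_v h (x + s *: v) ord0 j.
have dp (s : R) : is_derive s 1 ph (dph s).
  by apply: is_derive_coord; exact: is_derive_line.
have cp (a' b' : R) : {within `[a', b'], continuous ph}.
  apply: continuous_subspaceT => s; apply: differentiable_continuous.
  by apply/derivable1_diffP; case: (dp s).
have [t tc E] : exists2 t : R, `|t| <= `|c| & ph c - ph 0 = dph t * c.
  have [c0|c0] := leP 0 c.
    have [t] := MVT_segment c0 (fun s _ => dp s) (@cp _ _).
    rewrite in_itv/= subr0 => /andP[t0 tc] E; exists t => //.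
    by rewrite !ger0_norm.
  have [t] := MVT_segment (ltW c0) (fun s _ => dp s) (@cp _ _).
  rewrite in_itv/= => /andP[ct t0] E; exists t.
    by rewrite !ler0_norm ?lerN2// ltW.
  by rewrite -opprB E sub0r mulrN opprK.
have -> : (h (x + c *: v) - h x - c *: a) ord0 j = c * ('D_v h (x + t *: v) - a) ord0 j.
  by move: E; rewrite /ph /dph scale0r addr0 !mxE => ->; ring.
by rewrite normrM ler_wpM2l// (le_trans (norm_coord_le _ _))// He.
Qed.

Lemma nbhs_distP (V : normedModType R) (x : V) (P : set V) :
  nbhs x P <-> exists2 d : R, 0 < d & forall y, `|x - y| < d -> P y.
Proof.
by split=> [/nbhs_normP[d d0 Hd]|[d d0 Hd]]; [|apply/nbhs_normP];
  exists d => // y; have := Hd y.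
Qed.

Lemma continuous_distP (V W : normedModType R) (h : V -> W) (x : V) :
  {for x, continuous h} -> forall e : R, 0 < e ->
  exists2 d : R, 0 < d & forall y, `|x - y| < d -> `|h x - h y| < e.
Proof.
move=> /cvgrPdist_lt ch e e0.
by apply/(nbhs_distP x [set y | `|h x - h y| < e]); exact: ch.
Qed.

(** These are the vertices of the coordinate path from 0 to [u], along which increments are
    telescoped. *)
Definition row_prefix n k (u : 'rV[R]_n) : 'rV[R]_n :=
  \row_i (if (i < k)%N then u ord0 i else 0).

Lemma row_prefixS n (u : 'rV[R]_n) (k : 'I_n) :
  row_prefix k.+1 u = row_prefix k u + u ord0 k *: delta_mx ord0 k.
Proof.
apply/rowP => i; rewrite !mxE eqxx/= ltnS leq_eqVlt.
have [->|ik] := eqVneq i k; first by rewrite ltnn !eqxx/= mulr1 add0r.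
by rewrite (negbTE (ik : val i != val k)) /= mulr0 addr0.
Qed.

(** The increment of [h] is split along the coordinate path. By the mean value theorem, each piece
    differs from its linear part by little, since the partial derivatives are continuous at [x]. *)
Lemma C1_differentiable m n (h : 'rV[R]_m -> 'rV[R]_n) x :
  (forall y v, derivable h y v) -> (forall v, continuous ('D_v h)) ->
  differentiable h x.
Proof.
move=> dh ch.
pose J : 'M[R]_(m, n) := \matrix_i 'D_(delta_mx ord0 i) h x.
pose df : {linear 'rV[R]_m -> 'rV[R]_n} := mulmxr J.
have dfE u : df u = \sum_i u ord0 i *: 'D_(delta_mx ord0 i) h x.
  by rewrite /= mulmx_sum_row; apply: eq_bigr => i _; rewrite rowK.
have cdf : continuous df.
  rewrite (_ : (df : _ -> _) =
    (fun u => \sum_i u ord0 i *: 'D_(delta_mx ord0 i) h x)); last exact/funext.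
  apply: continuous_big => [|i _ u]; first exact: add_continuous.
  exact: (cvgZr_tmp (@coord_continuous R 1 m ord0 i u)).
have hdf : h \o shift x = cst (h x) + df +o_ 0 id.
  apply/eqaddoP => _/posnumP[e].
  (* Each of the [m] pieces contributes an error of at most |u| e'; the denominator m + 1 is nonzero
     also for m = 0. *)
  pose e' := e%:num / m.+1%:R.
  have e'0 : 0 < e' by rewrite divr_gt0.
  have Hi (i : 'I_m) : nbhs (0 : 'rV[R]_m) [set z |
      `|'D_(delta_mx ord0 i) h (x + z) - 'D_(delta_mx ord0 i) h x| < e'].
    have [d d0 Hd] := continuous_distP (ch (delta_mx ord0 i) x) e'0.
    apply/nbhs_distP; exists d => // z; rewrite sub0r normrN => zd /=.
    by rewrite distrC; apply: Hd; rewrite opprD addrA subrr sub0r normrN.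
  have Hn : nbhs (0 : 'rV[R]_m) [set z | forall i : 'I_m,
      `|'D_(delta_mx ord0 i) h (x + z) - 'D_(delta_mx ord0 i) h x| < e'].
    exact: filter_forall Hi.
  have [d d0 Hd] := (nbhs_distP _ _).1 Hn.
  apply/nbhs_distP; exists d => // u; rewrite sub0r normrN => ud.
  have Hs (k : nat) : (k <= m)%N ->
     `|h (x + row_prefix k u) - h x - \sum_(i < m | (i < k)%N) u ord0 i *: 'D_(delta_mx ord0 i) h x|
       <= k%:R * (`|u| * e').
    elim: k => [_|k IH km].
      rewrite big_pred0// subr0 mul0r (_ : row_prefix 0 u = 0); last first.
        by apply/rowP => i; rewrite !mxE.
      by rewrite addr0 subrr normr0.
    pose k' := Ordinal km.
    rewrite (row_prefixS u k') (bigD1 k')//= (eq_bigl (fun i : 'I_m => (i < k)%N)); last first.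
      move=> i /=; rewrite ltnS leq_eqVlt (_ : (i != k') = (val i != k))//.
      by case: ltngtP.
    have := @mean_value_bound _ _ h (x + row_prefix k u) (delta_mx ord0 k')
       ('D_(delta_mx ord0 k') h x) (u ord0 k') e' (fun y => dh _ _).
    move=> /(_ _)/wrap[t tu|Hk].
      rewrite -addrA; apply/ltW/Hd; rewrite sub0r normrN.
      apply: le_lt_trans ud; apply: norm_row_le => // i; rewrite !mxE eqxx /=.
      have [->|ik] := eqVneq i k'.
        by rewrite ltnn add0r mulr1 (le_trans tu)// norm_coord_le.
      by rewrite mulr0 addr0; case: ifP; rewrite ?normr0// norm_coord_le.
    rewrite -[X in X%:R * _]addn1 natrD mulrDl mul1r.
    apply: le_trans (_ : _ <= `|u ord0 k'| * e' + k%:R * (`|u| * e')) _; last first.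
      by rewrite addrC lerD2l ler_wpM2r ?norm_coord_le// ltW.
    apply: le_trans (lerD Hk (IH (ltnW km))); apply: le_trans (ler_normD _ _).
    rewrite [in leLHS]addrA le_eqVlt; apply/orP; left; apply/eqP; congr `|_|.
    set S1 := \sum_(i < m | _) _; set h1 := h _; set h2 := h (x + row_prefix k u).
    by apply/rowP => j; rewrite !mxE; ring.
  have := Hs m (leqnn m).
  rewrite (eq_bigl xpredT) => [|i]; last by rewrite ltn_ord.
  rewrite (_ : row_prefix m u = u); last by apply/rowP => i; rewrite !mxE ltn_ord.
  rewrite -dfE /= => H.
  rewrite -![(_ + _ : _ -> _) _]/(_ + _) -![(- _ : _ -> _) _]/(- _) /cst /=.
  rewrite opprD addrA [u + x]addrC (le_trans H)//.
  rewrite /e' mulrCA mulrC ler_wpM2r// mulrC -mulrA ler_piMr//.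
  by rewrite mulrC ler_pdivrMr ?ltr0n// mul1r ler_nat.
by apply/diff_locallyP; rewrite (diff_unique cdf hdf).
Qed.

End DirectionalDerivatives.

(** * Smooth maps and linearity of their derivatives *)

Section SmoothMaps.
Variables (R : realType) (p q : nat).
Implicit Types (f g : 'rV[R]_p -> 'rV[R]_q) (u v w x : 'rV[R]_p) (vs ws : seq 'rV[R]_p).

Lemma iterD_cat f vs ws : iterD f (vs ++ ws) = iterD (iterD f ws) vs.
Proof. by elim: vs => //= v vs ->. Qed.

Lemma smooth_iterD f ws : smooth f -> smooth (iterD f ws).
Proof. by move=> sf vs; rewrite -iterD_cat; exact: sf. Qed.

Lemma smooth_derivable f vs x v : smooth f -> derivable (iterD f vs) x v.
Proof. by move=> sf; exact: (sf vs).2. Qed.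

(** [smooth] speaks of directional derivatives only. Total differentiability is what gives the chain
    rule and the linearity of the derivative in its direction. *)
Lemma smooth_differentiable f vs x : smooth f -> differentiable (iterD f vs) x.
Proof.
move=> sf; apply: C1_differentiable => [y v|v]; first exact: smooth_derivable.
exact: (sf (v :: vs)).1.
Qed.

Lemma is_derive_lincomb f g (s t : R) x v df dg :
  is_derive x v f df -> is_derive x v g dg ->
  is_derive x v (fun y => s *: f y + t *: g y) (s *: df + t *: dg).
Proof. by move=> hf hg; exact: (is_deriveD (is_deriveZ s hf) (is_deriveZ t hg)). Qed.

Lemma iterD_lincomb f g (s t : R) vs : smooth f -> smooth g ->
  iterD (fun y => s *: f y + t *: g y) vs =
  (fun y => s *: iterD f vs y + t *: iterD g vs y).
Proof.
move=> sf sg; elim: vs => //= v vs IH; apply/funext => x; rewrite IH.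
by apply: (@derive_val _ _ _ _ _ _ _ (is_derive_lincomb _ _ _ _));
  apply: derivableP; exact: smooth_derivable.
Qed.

Lemma smooth_lincomb f g (s t : R) : smooth f -> smooth g ->
  smooth (fun y => s *: f y + t *: g y).
Proof.
move=> sf sg vs; rewrite iterD_lincomb//; split=> [x|x v].
  apply: (@continuousD _ _ _ (fun y => s *: iterD f vs y) (fun y => t *: iterD g vs y)).
    exact: cvgZl_tmp ((sf vs).1 x).
  exact: cvgZl_tmp ((sg vs).1 x).
by apply: (@ex_derive _ _ _ _ _ _ _ (is_derive_lincomb _ _ _ _));
  apply: derivableP; exact: smooth_derivable.
Qed.

Lemma fsub_lincomb f g : fsub f g = (fun y => 1 *: f y + (- 1) *: g y).
Proof. by apply/funext => y; rewrite /fsub scale1r scaleN1r. Qed.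

Lemma iterD_fsub f g vs x : smooth f -> smooth g ->
  iterD (fsub f g) vs x = iterD f vs x - iterD g vs x.
Proof. by move=> sf sg; rewrite fsub_lincomb iterD_lincomb// scale1r scaleN1r. Qed.

Lemma smooth_fsub f g : smooth f -> smooth g -> smooth (fsub f g).
Proof. by move=> sf sg; rewrite fsub_lincomb; exact: smooth_lincomb. Qed.

Lemma add_lincomb f g : (fun y => f y + g y) = (fun y => 1 *: f y + 1 *: g y).
Proof. by apply/funext => y; rewrite !scale1r. Qed.

Lemma smooth_add f g : smooth f -> smooth g -> smooth (fun y => f y + g y).
Proof. by move=> sf sg; rewrite add_lincomb; exact: smooth_lincomb. Qed.

Lemma iterD_cst0 vs : iterD (fun _ : 'rV[R]_p => 0 : 'rV[R]_q) vs = fun=> 0.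
Proof. by elim: vs => //= v vs ->; apply/funext => x; exact: derive_cst. Qed.

Lemma smooth_cst0 : smooth (fun _ : 'rV[R]_p => 0 : 'rV[R]_q).
Proof.
move=> vs; rewrite iterD_cst0; split=> [|x v]; first exact: cst_continuous.
exact: derivable_cst.
Qed.

Lemma smooth_iterD_sum I (r : seq I) (c : I -> R) (F : I -> 'rV[R]_p -> 'rV[R]_q) :
  (forall i, smooth (F i)) ->
  smooth (fun y => \sum_(i <- r) c i *: F i y) /\
  forall vs, iterD (fun y => \sum_(i <- r) c i *: F i y) vs =
    (fun y => \sum_(i <- r) c i *: iterD (F i) vs y).
Proof.
move=> sF; elim: r => [|i r [IHs IHd]].
  under eq_fun do rewrite big_nil.
  split=> [|vs]; first exact: smooth_cst0.
  by under [RHS]eq_fun do rewrite big_nil; exact: iterD_cst0.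
have E : (fun y => \sum_(j <- i :: r) c j *: F j y) =
   (fun y => c i *: F i y + 1 *: \sum_(j <- r) c j *: F j y).
  by apply/funext => y; rewrite big_cons scale1r.
rewrite E; split=> [|vs]; first exact: (smooth_lincomb (c i) 1 (sF i) IHs).
rewrite (iterD_lincomb (c i) 1 vs (sF i) IHs) IHd; apply/funext => y.
by rewrite big_cons scale1r.
Qed.

Lemma derive_lincomb f vs (c : R) u w x : smooth f ->
  'D_(c *: u + w) (iterD f vs) x = c *: 'D_u (iterD f vs) x + 'D_w (iterD f vs) x.
Proof.
move=> sf; have df : differentiable (iterD f vs) x by exact: smooth_differentiable.
by rewrite !deriveE// linearP.
Qed.

Lemma derive_row_sum f u x : smooth f ->
  'D_u f x = \sum_i u ord0 i *: 'D_(delta_mx ord0 i) f x.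
Proof.
move=> sf; have df : differentiable f x := @smooth_differentiable f [::] x sf.
rewrite deriveE// [in LHS](row_sum_delta u) linear_sum; apply: eq_bigr => i _.
by rewrite linearZ deriveE.
Qed.

End SmoothMaps.

(** * Bounds for multilinear maps *)

Section Multilinear.
Variables (R : realType) (m n : nat).
Implicit Types (T : seq 'rV[R]_m -> 'rV[R]_n) (us ws : seq 'rV[R]_m).

(** Lists of every length are allowed, so that a single predicate covers the derivatives of all
    orders at a point. *)
Definition multilin T := forall (c : R) u w (a b : seq 'rV[R]_m),
  T (a ++ (c *: u + w) :: b) = c *: T (a ++ u :: b) + T (a ++ w :: b).

Definition unit_vecs (us : seq 'rV[R]_m) := all (fun v => `|v| <= 1) us.

Lemma multilin_cons T w : multilin T -> multilin (fun l => T (w :: l)).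
Proof. by move=> mT c u w' a b; exact: (mT c u w' (w :: a) b). Qed.

Lemma multilin_headZ T (c : R) u l : multilin T -> T (c *: u :: l) = c *: T (u :: l).
Proof.
move=> mT; have E0 : T (0 :: l) = 0.
  have := mT 0 0 0 [::] l; rewrite /= scale0r addr0 scale0r add0r => E.
  have := mT (-1) 0 0 [::] l.
  by rewrite /= scaleN1r oppr0 addr0 scaleN1r addNr.
by have := mT c u 0 [::] l; rewrite /= addr0 E0 addr0.
Qed.

Lemma multilin_head_bound T (B : R) w us : multilin T ->
  (forall u, `|u| <= 1 -> `|T (u :: us)| <= B) -> `|T (w :: us)| <= B * `|w|.
Proof.
move=> mT HB.
have E : w = `|w| *: (`|w|^-1 *: w).
  have [->|w0] := eqVneq w 0; first by rewrite normr0 scale0r.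
  by rewrite scalerKV// normr_eq0.
rewrite [in leLHS]E multilin_headZ// normrZ normr_id mulrC ler_wpM2r//.
apply: HB; rewrite normrZ normfV normr_id.
have [->|w0] := eqVneq w 0; first by rewrite normr0 mulr0.
by rewrite mulVf ?normr_eq0.
Qed.

Lemma multilin_bound ws T (B : R) : multilin T ->
  (forall us, size us = size ws -> unit_vecs us -> `|T us| <= B) ->
  `|T ws| <= B * \prod_(w <- ws) `|w|.
Proof.
elim: ws T B => [|w ws IH] T B mT HB; first by rewrite big_nil mulr1; exact: HB.
rewrite big_cons mulrA; apply: (IH (fun l => T (w :: l))) => [|us sus uus].
  exact: multilin_cons.
apply: multilin_head_bound => // u u1; apply: HB => /=; first by rewrite sus.
by rewrite u1.
Qed.

(** The entries are exchanged one at a time; each exchange costs a factor [d] relative to the common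
    bound [c i], and there are [size r] exchanges. *)
Lemma multilin_diff_bound (I : Type) (r : seq I) (w w' : I -> 'rV[R]_m) (c : I -> R)
    (d : R) T (B : R) : multilin T -> 0 <= d ->
  (forall us, size us = size r -> unit_vecs us -> `|T us| <= B) ->
  (forall i, [/\ `|w i| <= c i, `|w' i| <= c i & `|w' i - w i| <= d * c i]) ->
  `|T (map w' r) - T (map w r)| <= B * (size r)%:R * d * \prod_(i <- r) c i.
Proof.
move=> + d0 + Hw; have c0 i : 0 <= c i by have [h _ _] := Hw i; exact: le_trans h.
elim: r T B => [|i r IH] T B mT HB.
  by rewrite /= subrr normr0 mulr0 !mul0r.
have B0 : 0 <= B.
  apply: le_trans (HB (nseq (size r).+1 0) _ _); rewrite ?size_nseq//.
  by rewrite /unit_vecs all_nseq normr0 ler01 orbT.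
rewrite /= big_cons.
have -> : T (w' i :: map w' r) - T (w i :: map w r) =
   T ((w' i - w i) :: map w' r) + (T (w i :: map w' r) - T (w i :: map w r)).
  have -> : T ((w' i - w i) :: map w' r) = T (w' i :: map w' r) - T (w i :: map w' r).
    rewrite -(scaleN1r (w i)) addrC.
    have := mT (-1) (w i) (w' i) [::] (map w' r); rewrite /= => ->.
    by rewrite scaleN1r addrC.
  by rewrite addrA subrK.
have [wi wi' wd] := Hw i.
apply: le_trans (ler_normD _ _) _.
rewrite -[(size r).+1]add1n natrD mulrDr mulr1 !mulrDl; apply: lerD.
  rewrite -!mulrA; apply: le_trans (_ : B * \prod_(u <- w' i - w i :: map w' r) `|u| <= _).
    by apply: multilin_bound => // us; rewrite /= size_map => /HB.
  rewrite ler_wpM2l// big_cons mulrA ler_pM ?prodr_ge0// big_map.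
  by apply: ler_prod => j _; have [_ -> _] := Hw j; rewrite normr_ge0.
have := IH (fun l => T (w i :: l)) (B * c i) (multilin_cons (w i) mT) _.
move=> /(_ _)/wrap[us sus uus|]; last first.
  by move=> /le_trans; apply; rewrite le_eqVlt; apply/orP; left; apply/eqP; ring.
apply: (@le_trans _ _ (B * `|w i|)); last by rewrite ler_wpM2l.
apply: multilin_head_bound => // u u1; apply: HB => /=; first by rewrite sus.
by rewrite u1.
Qed.

End Multilinear.

Section MultilinearDerivative.
Variables (R : realType) (p q : nat).

Lemma multilin_iterD (f : 'rV[R]_p -> 'rV[R]_q) y : smooth f ->
  multilin (fun ws => iterD f ws y).
Proof.
move=> sf c u w a b; rewrite iterD_cat [iterD f (_ :: b)]/=.
have -> : (fun x => 'D_(c *: u + w) (iterD f b) x) =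
   (fun x => c *: iterD f (u :: b) x + 1 *: iterD f (w :: b) x).
  by apply/funext => x; rewrite derive_lincomb// scale1r.
rewrite (iterD_lincomb c 1 a (smooth_iterD (u :: b) sf) (smooth_iterD (w :: b) sf)).
by rewrite scale1r -!iterD_cat.
Qed.

Lemma multilin_sub (T1 T2 : seq 'rV[R]_p -> 'rV[R]_q) :
  multilin T1 -> multilin T2 -> multilin (fun ws => T1 ws - T2 ws).
Proof.
by move=> h1 h2 c u w a b; rewrite h1 h2 scalerBr opprD addrACA.
Qed.

End MultilinearDerivative.

(** * Faa di Bruno's formula *)

Section SetPartitions.
Variable T : Type.
Implicit Types (v : T) (vs : seq T) (t : seq (seq T)).

(** Partitions are lists of blocks and follow the rules of differentiation: a new derivation either
    hits [f] and opens a block of its own, or hits one of the factors and joins its block. *)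
Fixpoint insert_block v t : seq (seq (seq T)) :=
  if t is B :: t' then ((v :: B) :: t') :: [seq B :: s | s <- insert_block v t']
  else [::].

Definition extend_partition v t := ([:: v] :: t) :: insert_block v t.

Fixpoint partitions vs : seq (seq (seq T)) :=
  if vs is v :: vs' then flatten [seq extend_partition v t | t <- partitions vs']
  else [:: [::]].

(** The product rule will peel off the last block, whereas [insert_block] recurses on the first
    one. *)
Lemma insert_block_rcons v t B :
  insert_block v (rcons t B) =
  rcons [seq rcons s B | s <- insert_block v t] (rcons t (v :: B)).
Proof.
elim: t => //= A t ->; rewrite map_rcons -map_comp; congr (_ :: rcons _ _).
by rewrite -map_comp.
Qed.

End SetPartitions.

Section FaaDiBruno.
Variables (R : realType) (p q r : nat).

Lemma is_derive_scale (V : normedModType R) n (a : V -> R) (F : V -> 'rV[R]_n)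
    x v da dF : is_derive x v a da -> is_derive x v F dF ->
  is_derive x v (fun y => a y *: F y) (da *: F x + a x *: dF).
Proof.
move=> ha hF.
have H i : is_derive x v (fun y => (a y *: F y) ord0 i) (a x * dF ord0 i + F x ord0 i * da).
  rewrite (_ : (fun y => _) = a * (fun y => F y ord0 i)); last first.
    by apply/funext => y; rewrite mxE.
  exact: (is_deriveM ha (is_derive_coord i hF)).
have dd : derivable (fun y => a y *: F y) x v.
  by apply/derivable_mxP => i j; rewrite (ord1 i); case: (H j).
split=> //; rewrite derive_mx//; apply/rowP => i; rewrite !mxE.
have [_ ->] := H i; ring.
Qed.

Lemma is_derive_sum_seq (V W : normedModType R) I (l : seq I) (F : I -> V -> W)
    (d : I -> W) x v : (forall i, is_derive x v (F i) (d i)) ->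
  is_derive x v (fun y => \sum_(i <- l) F i y) (\sum_(i <- l) d i).
Proof.
move=> H; elim: l => [|i l IH].
  rewrite big_nil (_ : (fun y => _) = cst 0); first exact: is_derive_cst.
  by apply/funext => y; rewrite big_nil.
rewrite big_cons (_ : (fun y => _) = F i + (fun y => \sum_(i <- l) F i y)).
  exact: is_deriveD.
by apply/funext => y; rewrite big_cons.
Qed.

Variables (g : 'rV[R]_p -> 'rV[R]_q).
Hypothesis sg : smooth g.

(** The summand f^(j)(g(x))(g^(B_1)(x), ..., g^(B_j)(x)) of Faa di Bruno's formula for the blocks
    B_1, ..., B_j. *)
Definition fdb_term (f : 'rV[R]_q -> 'rV[R]_r) (t : seq (seq 'rV[R]_p)) x :=
  iterD f [seq iterD g B x | B <- t] (g x).

(** Expanding the innermost direction in the standard basis moves its dependence on [x] into scalar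
    coefficients; what remains is a term of the same kind for a fixed smooth map, with one block
    fewer. *)
Lemma fdb_term_rcons f t B x : smooth f ->
  fdb_term f (rcons t B) x =
  \sum_i iterD g B x ord0 i *: fdb_term (iterD f [:: delta_mx ord0 i]) t x.
Proof.
move=> sf; rewrite /fdb_term map_rcons -cats1 iterD_cat.
have -> : iterD f [:: iterD g B x] =
    (fun y => \sum_i iterD g B x ord0 i *: iterD f [:: delta_mx ord0 i] y).
  by apply/funext => y; exact: derive_row_sum.
have [_ ->//] := @smooth_iterD_sum R q r 'I_q (index_enum 'I_q)
  (fun i => iterD g B x ord0 i) (fun i => iterD f [:: delta_mx ord0 i])
  (fun i => smooth_iterD [:: delta_mx ord0 i] sf).
Qed.

(* The innermost direction is peeled off, so that the symmetry of higher
   derivatives is never needed. *)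
Lemma is_derive_fdb_term t f : smooth f ->
  continuous (fdb_term f t) /\ forall x v, is_derive x v (fdb_term f t)
    (\sum_(s <- extend_partition v t) fdb_term f s x).
Proof.
elim/last_ind: t f => [|t B IH] f sf.
  have dfg x : differentiable (f \o g) x.
    by apply: differentiable_comp; [exact: (@smooth_differentiable _ _ _ g [::])|
      exact: (@smooth_differentiable _ _ _ f [::])].
  split=> [x|x v]; first exact: differentiable_continuous.
  split; first exact: diff_derivable.
  rewrite big_seq1 /fdb_term /= (deriveE _ (dfg x)) diff_comp/=.
  - rewrite !deriveE//.
    + exact: (@smooth_differentiable _ _ _ g [::]).
    + exact: (@smooth_differentiable _ _ _ f [::]).
  - exact: (@smooth_differentiable _ _ _ g [::]).
  - exact: (@smooth_differentiable _ _ _ f [::]).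
pose fi (i : 'I_q) := iterD f [:: delta_mx ord0 i].
have sfi i : smooth (fi i) by exact: smooth_iterD.
have E : fdb_term f (rcons t B) =
  (fun x => \sum_i iterD g B x ord0 i *: fdb_term (fi i) t x).
  by apply/funext => x; rewrite fdb_term_rcons.
split=> [|x v]; rewrite E.
  apply: continuous_big => [|i _ x]; first exact: add_continuous.
  have cc : {for x, continuous (fun y => iterD g B y ord0 i)}.
    apply: (@continuous_comp _ _ _ (iterD g B) (fun u : 'rV[R]_q => u ord0 i)).
      exact: (sg B).1.
    exact: coord_continuous.
  exact: (cvgZ cc ((IH _ (sfi i)).1 x)).
pose h i y := iterD g B y ord0 i *: fdb_term (fi i) t y.
pose dh i := 'D_v (iterD g B) x ord0 i *: fdb_term (fi i) t x +
  iterD g B x ord0 i *: \sum_(s <- extend_partition v t) fdb_term (fi i) s x.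
have Hh i : is_derive x v (h i) (dh i).
  apply: is_derive_scale; last exact: (IH _ (sfi i)).2.
  by apply: is_derive_coord; apply: derivableP; exact: smooth_derivable.
have -> : (fun x => \sum_i iterD g B x ord0 i *: fdb_term (fi i) t x) = \sum_i h i.
  by apply/funext => y; rewrite fct_sumE.
apply: is_derive_eq; rewrite /dh big_split/=.
(* A derivative of a coefficient puts [v] into the last block [B]; a derivative of the remaining
   term extends [t] and leaves [B] alone. *)
rewrite /extend_partition big_cons insert_block_rcons -[rcons (map _ _) _]cats1 big_cat big_seq1/=.
rewrite -rcons_cons (fdb_term_rcons ([:: v] :: t) B x sf) (fdb_term_rcons t (v :: B) x sf) big_map.
rewrite addrA addrC; congr (_ + _).
under eq_bigr do rewrite big_cons scalerDr.
rewrite big_split/=; congr (_ + _).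
under [RHS]eq_bigr do rewrite (fdb_term_rcons _ B x sf).
rewrite exchange_big/=; apply: eq_bigr => i _.
by rewrite scaler_sumr.
Qed.

Lemma iterD_comp f vs : smooth f ->
  iterD (f \o g) vs = (fun x => \sum_(t <- partitions vs) fdb_term f t x).
Proof.
move=> sf; elim: vs => [|v vs IH] /=.
  by apply/funext => x; rewrite big_seq1.
apply/funext => x; rewrite IH big_flatten big_map /=.
by have [_ ->] := is_derive_sum_seq (partitions vs)
  (fun t => (is_derive_fdb_term t sf).2 x v).
Qed.

Lemma smooth_comp (f : 'rV[R]_q -> 'rV[R]_r) : smooth f -> smooth (f \o g).
Proof.
move=> sf vs; rewrite iterD_comp//; split=> [|x v].
  apply: continuous_big => [|t _]; first exact: add_continuous.
  exact: (is_derive_fdb_term t sf).1.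
by have [] := is_derive_sum_seq (partitions vs)
  (fun t => (is_derive_fdb_term t sf).2 x v).
Qed.

End FaaDiBruno.

(** * Total weight of the set partitions *)

Section PartitionWeights.
Variables (R : realType) (T : eqType) (P : pred T).
Implicit Types (v : T) (vs B : seq T) (t s : seq (seq T)).

(** The block sizes form an admissible index in the maximum that defines [circ], and [P] will say
    that the directions lie in the unit ball. *)
Definition is_partition k t :=
  all (fun B => (0 < size B)%N && all P B) t && (sumn (map size t) == k).

Lemma insert_block_partition v t k : P v -> is_partition k t ->
  all (fun s => is_partition k.+1 s && (size s == size t)) (insert_block v t).
Proof.
move=> Pv; elim: t k => //= B t IH k /andP[/= /andP[/andP[B0 PB] Pt] /eqP <-].
rewrite /is_partition /= PB Pt Pv addSn !eqxx/= all_map.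
have := IH _ (introT andP (conj Pt (eqxx _))); apply: sub_all => s /=.
by move=> /andP[/andP[-> /eqP->] /eqP->]; rewrite B0 PB /= addnS !eqxx.
Qed.

Lemma partitions_partition vs : all P vs ->
  all (is_partition (size vs)) (partitions vs).
Proof.
elim: vs => //= v vs IH /andP[Pv /IH].
elim: (partitions vs) => //= t ts IHt /andP[Pt /IHt Hts]; rewrite all_cat Hts andbT andbC.
apply/andP; split; last first.
  by case/andP: Pt => Pt /eqP St; rewrite /is_partition /= Pt Pv add1n St eqxx.
by have := insert_block_partition Pv Pt; apply: sub_all => s /andP[].
Qed.

Lemma is_partition_size k t : is_partition k t -> (size t <= k)%N.
Proof.
case/andP=> + /eqP <-; elim: t => //= B t IH /andP[/andP[B0 _] /IH H].
by rewrite -add1n leq_add.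
Qed.

Definition block_weight t : R := \prod_(B <- t) (size B)`!%:R.

Lemma block_weight_ge0 t : 0 <= block_weight t.
Proof. by rewrite /block_weight prodr_ge0// => B _; rewrite ler0n. Qed.

(** Enlarging a block of size b multiplies the weight by b + 1; these factors add up to the number
    of points plus the number of blocks. *)
Lemma sum_insert_block_weight v t :
  \sum_(s <- insert_block v t) block_weight s =
  (sumn (map size t) + size t)%:R * block_weight t.
Proof.
rewrite /block_weight.
elim: t => [|B t IH] /=; first by rewrite !big_nil mul0r.
rewrite big_cons big_map; under [X in _ + X = _]eq_bigr do rewrite big_cons.
rewrite -mulr_sumr IH !big_cons /= factS natrM !natrD -addn1 !natrD -[(size t).+1]addn1 natrD.
ring.
Qed.

(* Adding a point to a partition of [k] points with [j <= k] blocks multiplies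
   the total weight by [(j + 1) z + k + j <= (k + 1) (2 + z)]. *)
Lemma sum_partitions_weight (z : R) vs : 0 <= z -> all P vs ->
  \sum_(t <- partitions vs) (size t)`!%:R * z ^+ size t * block_weight t
  <= (size vs)`!%:R * (2 + z) ^+ size vs.
Proof.
move=> z0; elim: vs => [|v vs IH] /=.
  by rewrite big_seq1 /block_weight big_nil expr0 !mulr1.
move=> /andP[Pv Pvs].
rewrite big_flatten big_map /= factS natrM exprS mulrACA.
apply: le_trans (_ : _ <= (size vs).+1%:R * (2 + z) * \sum_(t <- partitions vs)
  (size t)`!%:R * z ^+ size t * block_weight t) _; last first.
  by rewrite ler_wpM2l ?IH// mulr_ge0// addr_ge0.
rewrite mulr_sumr; have := partitions_partition Pvs.
elim: (partitions vs) => [|t ts IHt]; first by rewrite !big_nil.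
move=> /= /andP[Pt /IHt H]; rewrite !big_cons lerD//.
have jk := is_partition_size Pt.
have := insert_block_partition Pv Pt.
have := sum_insert_block_weight v t; case/andP: Pt => _ /eqP ->.
move=> E /allP Hs.
rewrite (eq_big_seq (fun s => (size t)`!%:R * z ^+ size t * block_weight s)).
  rewrite -mulr_sumr E /block_weight big_cons -/(block_weight t) /= factS natrM exprS mul1r.
  set A := (size t)`!%:R * z ^+ size t * block_weight t.
  have A0 : 0 <= A by rewrite !mulr_ge0 ?ler0n ?exprn_ge0 ?block_weight_ge0.
  apply: le_trans (_ : _ <= ((size t).+1%:R * z + (size vs + size t)%:R) * A) _.
    by rewrite le_eqVlt; apply/orP; left; apply/eqP; rewrite /A; ring.
  rewrite ler_wpM2r// mulrDr addrC lerD// -?natrM ?ler_nat ?ler_wpM2r ?ler_nat//.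
  by rewrite muln2 -addnn addSn leqW// leq_add// leqW.
by move=> s /Hs/andP[_ /eqP->].
Qed.

End PartitionWeights.

(** * Bounds for the derivatives of a composition *)

Section CompositionBounds.
Variable R : realType.

(** The bound [C] on the weighted norm with denominators cleared, see [wnorm_le_bnd]; it is handled
    within the reals. *)
Definition bnd p q (M : nat -> R) (K : set 'rV[R]_p) (rho : R)
    (f : 'rV[R]_p -> 'rV[R]_q) (C : R) :=
  forall x vs, K x -> unit_vecs vs ->
    `|iterD f vs x| <= C * ((size vs)`!%:R * rho ^+ size vs * M (size vs)).

Lemma circ_ge (T : eqType) (P : pred T) (M : nat -> R) k (t : seq (seq T)) :
  M 0%N = 1 -> (forall j, 0 < M j) -> is_partition P k t ->
  M (size t) * \prod_(B <- t) M (size B) <= circ M k.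
Proof.
move=> M0 Mp Pt; have jk := is_partition_size Pt.
rewrite /circ; case: ifPn => [/eqP k0|kn0].
  move: jk; rewrite k0 leqn0 => /nilP->.
  by rewrite big_nil mulr1 M0.
case/andP: Pt => /allP Pt /eqP St.
have Sle (B : seq T) : B \in t -> (size B < k.+1)%N.
  by move=> Bt; rewrite ltnS -St sumnE big_map (big_rem B)//= leq_addr.
pose j : 'I_k.+1 := Ordinal (jk : (size t < k.+1)%N).
(* The block sizes of [t], in order, are an index of the maximum; each is at most [k], so [inord]
   does not alter it. *)
pose a : {ffun 'I_j -> 'I_k.+1} := [ffun i : 'I_j => inord (size (nth [::] t i))].
have aE i : a i = size (nth [::] t i) :> nat.
  by rewrite ffunE inordK// Sle// mem_nth.
apply: (@bigmax_sup _ _ _ _ j) => //.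
apply: (@bigmax_sup _ _ _ _ a).
  apply/andP; split.
    apply/forallP => i; rewrite aE.
    by have /Pt/andP[] : nth [::] t i \in t by exact: mem_nth.
  apply/eqP; rewrite -[RHS]St sumnE big_map (big_nth [::]) big_mkord.
  by apply: eq_bigr => i _; rewrite aE.
rewrite (big_nth [::]) big_mkord le_eqVlt; apply/orP; left; apply/eqP.
by congr (_ * _); apply: eq_bigr => i _; rewrite aE.
Qed.

Lemma circ_ge0 (M : nat -> R) k : 0 <= circ M k.
Proof.
rewrite /circ; case: ifP => // _; exact: bigmax_ge_id.
Qed.

Lemma sum_partitions_bound p n (vs : seq 'rV[R]_p)
    (X : seq (seq 'rV[R]_p) -> 'rV[R]_n) (Phi z : R) :
  0 <= z -> 0 <= Phi -> unit_vecs vs ->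
  (forall t, is_partition (fun v => `|v| <= 1) (size vs) t ->
     `|X t| <= Phi * ((size t)`!%:R * z ^+ size t * block_weight R t)) ->
  `|\sum_(t <- partitions vs) X t| <= Phi * ((size vs)`!%:R * (2 + z) ^+ size vs).
Proof.
move=> z0 P0 uvs HX.
apply: le_trans (ler_norm_sum _ _ _) _.
apply: le_trans (_ : _ <= Phi * \sum_(t <- partitions vs)
   (size t)`!%:R * z ^+ size t * block_weight R t) _; last first.
  by rewrite ler_wpM2l// (sum_partitions_weight z0 uvs).
rewrite mulr_sumr big_seq [leRHS]big_seq; apply: ler_sum => t tp.
by apply: HX; exact: (allP (partitions_partition uvs)).
Qed.

(** The factors are sorted: those of [s] and [G] count blocks, those of [sig] add up to the exponent
    [k], and the weights form a term of [circ M k]. *)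
Lemma partition_factor_le (T : eqType) (P : pred T) (M : nat -> R) k
    (t : seq (seq T)) (s sig G : R) :
  M 0%N = 1 -> (forall j, 0 < M j) -> is_partition P k t ->
  0 <= s -> 0 <= sig -> 0 <= G ->
  (size t)`!%:R * s ^+ size t * M (size t) *
    \prod_(B <- t) (G * ((size B)`!%:R * sig ^+ size B * M (size B)))
  <= sig ^+ k * circ M k * ((size t)`!%:R * (s * G) ^+ size t * block_weight R t).
Proof.
move=> M0 Mp Pt s0 sig0 G0.
have -> : \prod_(B <- t) (G * ((size B)`!%:R * sig ^+ size B * M (size B))) =
    G ^+ size t * (block_weight R t * sig ^+ k * \prod_(B <- t) M (size B)).
  case/andP: (Pt) => _ /eqP <-; rewrite !big_split/= big_const_seq count_predT.
  rewrite -Monoid.iteropE /= -[iterop _ _ _ _]/(G ^+ size t) /block_weight.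
  congr (_ * (_ * _ * _)); elim: (t) => [|B t' IH]; first by rewrite big_nil expr0.
  by rewrite big_cons IH /= exprD.
rewrite exprMn.
set W := block_weight R t; set Q := \prod_(_ <- _) _.
have -> : (size t)`!%:R * s ^+ size t * M (size t) * (G ^+ size t * (W * sig ^+ k * Q))
  = (sig ^+ k * ((size t)`!%:R * (s ^+ size t * G ^+ size t) * W)) * (M (size t) * Q).
  by ring.
rewrite [leRHS](_ : _ =
  (sig ^+ k * ((size t)`!%:R * (s ^+ size t * G ^+ size t) * W)) * circ M k); last by ring.
rewrite ler_wpM2l ?(circ_ge M0 Mp Pt)// !mulr_ge0 ?exprn_ge0 ?ler0n ?block_weight_ge0//.
Qed.

Variables (p q r : nat).

(** The constant [G] of the inner map is raised to the number of blocks, so it enters the new radius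
    only; the constant of the composition is that of [f]. *)
Lemma comp_bnd (f : 'rV[R]_q -> 'rV[R]_r) (g : 'rV[R]_p -> 'rV[R]_q)
    (M : nat -> R) K L (s sig F G : R) :
  M 0%N = 1 -> (forall j, 0 < M j) -> 0 <= s -> 0 <= sig -> 0 <= F -> 0 <= G ->
  smooth f -> smooth g -> (forall x, K x -> L (g x)) ->
  bnd M L s f F -> bnd M K sig g G ->
  bnd (circ M) K (sig * (2 + s * G)) (f \o g) F.
Proof.
move=> M0 Mp s0 sig0 F0 G0 sf sg KL bf bg x vs Kx uvs; have Mp0 j := ltW (Mp j).
rewrite iterD_comp// exprMn.
rewrite [leRHS](_ : _ = (F * (sig ^+ size vs * circ M (size vs))) *
   ((size vs)`!%:R * (2 + s * G) ^+ size vs)); last by ring.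
apply: sum_partitions_bound => // [||t Pt].
- by rewrite mulr_ge0.
- by rewrite !mulr_ge0 ?exprn_ge0 ?circ_ge0.
rewrite -mulrA; apply: le_trans (ler_wpM2l F0 (partition_factor_le M0 Mp Pt s0 sig0 G0)).
apply: le_trans (multilin_bound
  (B := F * ((size t)`!%:R * s ^+ size t * M (size t))) (multilin_iterD _ sf) _) _.
  by move=> us; rewrite size_map => <- uus; apply: bf => //; exact: KL.
rewrite -mulrA big_map ler_wpM2l//.
rewrite ler_wpM2l ?mulr_ge0 ?exprn_ge0 ?ler0n//.
rewrite big_seq [leRHS]big_seq; apply: ler_prod => B Bt; rewrite normr_ge0/=.
by case/andP: Pt => /allP/(_ _ Bt)/andP[_ uB] _; exact: bg.
Qed.

(** First the base point of the derivative of [f] is moved, at the cost [eta], and then its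
    arguments, at the cost of a factor j d for j blocks. Since j <= 2^j, doubling [s] in the radius
    absorbs j. *)
Lemma comp_diff_bnd (f : 'rV[R]_q -> 'rV[R]_r) (g g' : 'rV[R]_p -> 'rV[R]_q)
    (M : nat -> R) K L (s sig F G eta d : R) :
  M 0%N = 1 -> (forall j, 0 < M j) -> 0 <= s -> 0 <= sig -> 0 <= F -> 1 <= G ->
  0 <= eta -> 0 <= d ->
  smooth f -> smooth g -> smooth g' -> (forall x, K x -> L (g x)) ->
  bnd M L s f F -> bnd M K sig g G -> bnd M K sig g' G -> bnd M K sig (fsub g' g) d ->
  (forall x us, K x -> unit_vecs us -> `|iterD f us (g' x) - iterD f us (g x)| <=
     eta * ((size us)`!%:R * s ^+ size us * M (size us))) ->
  bnd (circ M) K (sig * (2 + 2 * s * G)) (fsub (f \o g') (f \o g)) (eta + F * d).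
Proof.
move=> M0 Mp s0 sig0 F0 G1 eta0 d0 sf sg sg' KL bf bg bg' bd Hm x vs Kx uvs.
have Mp0 j := ltW (Mp j).
have G0 : 0 <= G by exact: le_trans G1.
rewrite iterD_fsub; [|exact: smooth_comp|exact: smooth_comp].
rewrite !iterD_comp// -sumrB exprMn.
rewrite [leRHS](_ : _ = ((eta + F * d) * (sig ^+ size vs * circ M (size vs))) *
   ((size vs)`!%:R * (2 + 2 * s * G) ^+ size vs)); last by ring.
apply: sum_partitions_bound => // [||t Pt].
- by rewrite !mulr_ge0.
- by rewrite !mulr_ge0 ?exprn_ge0 ?circ_ge0 ?addr_ge0 ?mulr_ge0.
pose c (B : seq 'rV[R]_p) := G * ((size B)`!%:R * sig ^+ size B * M (size B)).
have c0 B : 0 <= c B by rewrite !mulr_ge0 ?exprn_ge0 ?ler0n.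
have uB B : B \in t -> unit_vecs B.
  by move=> Bt; case/andP: Pt => /allP/(_ _ Bt)/andP[].
(* The default value 0 off [t] makes the bounds hold for every [B], as [multilin_diff_bound]
   demands. *)
pose w B := if B \in t then iterD g B x else 0.
pose w' B := if B \in t then iterD g' B x else 0.
have wE : [seq iterD g B x | B <- t] = map w t.
  by apply/eq_in_map => B Bt; rewrite /w Bt.
have wE' : [seq iterD g' B x | B <- t] = map w' t.
  by apply/eq_in_map => B Bt; rewrite /w' Bt.
have Hw B : [/\ `|w B| <= c B, `|w' B| <= c B & `|w' B - w B| <= d * c B].
  rewrite /w /w'; case: ifPn => [/uB uuB|_]; last first.
    by rewrite subrr normr0 !c0 mulr_ge0.
  split; [exact: bg|exact: bg'|rewrite -iterD_fsub//].
  (* Here 1 <= G turns the bound on the difference into one relative to [c B]. *)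
  apply: le_trans (bd _ _ Kx uuB) _; rewrite ler_wpM2l// /c ler_peMl//.
  by rewrite !mulr_ge0 ?exprn_ge0 ?ler0n.
rewrite /fdb_term wE wE'.
set j := size t.
pose A := j`!%:R * s ^+ j * M j.
have A0 : 0 <= A by rewrite !mulr_ge0 ?exprn_ge0 ?ler0n.
have -> : iterD f (map w' t) (g' x) - iterD f (map w t) (g x) =
  (iterD f (map w' t) (g' x) - iterD f (map w' t) (g x)) +
  (iterD f (map w' t) (g x) - iterD f (map w t) (g x)) by rewrite addrA subrK.
apply: le_trans (ler_normD _ _) _.
have H1 : `|iterD f (map w' t) (g' x) - iterD f (map w' t) (g x)| <= eta * A * \prod_(B <- t) c B.
  apply: le_trans (multilin_bound
    (T := fun ws => iterD f ws (g' x) - iterD f ws (g x)) (B := eta * A) _ _) _.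
  - by apply: multilin_sub; exact: multilin_iterD.
  - by move=> us; rewrite size_map => su uus; rewrite /A /j -su; exact: Hm.
  - rewrite ler_wpM2l ?(mulr_ge0 eta0 A0)// big_map; apply: ler_prod => B _.
    by have [_ -> _] := Hw B; rewrite normr_ge0.
have H2 : `|iterD f (map w' t) (g x) - iterD f (map w t) (g x)|
    <= F * A * j%:R * d * \prod_(B <- t) c B.
  apply: (multilin_diff_bound (T := fun ws => iterD f ws (g x))) => //; first exact: multilin_iterD.
  by move=> us su uus; rewrite /A /j -su; apply: bf => //; exact: KL.
apply: le_trans (lerD H1 H2) _.
have Hf := partition_factor_le M0 Mp Pt (mulr_ge0 (ler0n R 2) s0) sig0 G0.
rewrite -[leRHS]mulrA.
apply: le_trans (ler_wpM2l (addr_ge0 eta0 (mulr_ge0 F0 d0)) Hf).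
rewrite -/c -/j exprMn.
set Pr := \prod_(_ <- _) _.
have Pr0 : 0 <= Pr by exact: prodr_ge0.
have j2 : j%:R <= 2 ^+ j :> R by rewrite -natrX ler_nat ltnW// ltn_expl.
have t1 : 1 <= 2 ^+ j :> R by rewrite -natrX ler1n expn_gt0.
rewrite [leRHS](_ : _ = (eta + F * d) * 2 ^+ j * (A * Pr)); last by rewrite /A; ring.
rewrite [leLHS](_ : _ = (eta + F * d * j%:R) * (A * Pr)); last by ring.
rewrite ler_wpM2r ?(mulr_ge0 A0 Pr0)// mulrDl lerD ?ler_peMr//.
by rewrite ler_wpM2l ?mulr_ge0.
Qed.

End CompositionBounds.

(** * Weighted bounds and continuity of composition *)

Section BoundAlgebra.
Variables (R : realType) (p q : nat).
Implicit Types (f g h : 'rV[R]_p -> 'rV[R]_q) (M N : nat -> R) (K : set 'rV[R]_p).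

Lemma bnd_mono M N K K' (rho rho' : R) f (C C' : R) :
  (forall x, K' x -> K x) -> 0 <= C -> C <= C' -> 0 <= rho -> rho <= rho' ->
  (forall k, 0 <= M k) -> (forall k, M k <= N k) ->
  bnd M K rho f C -> bnd N K' rho' f C'.
Proof.
move=> KK C0 CC r0 rr M0 MN bf x vs Kx uvs; apply: le_trans (bf x vs (KK _ Kx) uvs) _.
rewrite ler_pM// ?mulr_ge0 ?exprn_ge0 ?ler0n//.
by rewrite ler_pM// ?mulr_ge0 ?exprn_ge0 ?ler0n// ler_wpM2l// lerXn2r// nnegrE (le_trans r0).
Qed.

Lemma bnd_wpreceq M N K (rho A tau C : R) f :
  (forall k, M k <= A * tau ^+ k * N k) -> 0 <= rho -> 0 <= C ->
  bnd M K rho f C -> bnd N K (rho * tau) f (C * A).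
Proof.
move=> MN r0 C0 bf x vs Kx uvs; apply: le_trans (bf x vs Kx uvs) _.
rewrite exprMn.
rewrite [leRHS](_ : _ =
  C * ((size vs)`!%:R * rho ^+ size vs * (A * tau ^+ size vs * N (size vs)))); last by ring.
by rewrite !ler_wpM2l// mulr_ge0 ?exprn_ge0 ?ler0n.
Qed.

Lemma bnd_lincomb M K (rho : R) f g (s t C D : R) : smooth f -> smooth g ->
  bnd M K rho f C -> bnd M K rho g D ->
  bnd M K rho (fun y => s *: f y + t *: g y) (`|s| * C + `|t| * D).
Proof.
move=> sf sg bf bg x vs Kx uvs; rewrite iterD_lincomb//.
apply: le_trans (ler_normD _ _) _; rewrite !normrZ mulrDl -(mulrA `|s|) -(mulrA `|t|).
by apply: lerD; rewrite ler_wpM2l//; first [exact: bf | exact: bg].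
Qed.

Lemma bnd_add M K (rho : R) f g (C D : R) : smooth f -> smooth g ->
  bnd M K rho f C -> bnd M K rho g D -> bnd M K rho (fun y => f y + g y) (C + D).
Proof.
move=> sf sg bf bg; have := bnd_lincomb 1 1 sf sg bf bg.
by rewrite -add_lincomb normr1 !mul1r.
Qed.

Lemma bnd_scale M K (rho : R) f (c C : R) : smooth f ->
  bnd M K rho f C -> bnd M K rho (fun y => c *: f y) (`|c| * C).
Proof.
move=> sf bf; have := bnd_lincomb c 0 sf sf bf bf.
rewrite normr0 mul0r addr0; congr bnd; apply/funext => y.
by rewrite scale0r addr0.
Qed.

Lemma smooth_scale f (c : R) : smooth f -> smooth (fun y => c *: f y).
Proof.
move=> sf; have := smooth_lincomb c 0 sf sf; congr smooth; apply/funext => y.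
by rewrite scale0r addr0.
Qed.

Lemma bnd_cst0 M K (rho C : R) : 0 <= C -> 0 <= rho -> (forall k, 0 <= M k) ->
  bnd M K rho (fun _ : 'rV[R]_p => 0 : 'rV[R]_q) C.
Proof.
by move=> C0 r0 M0 x vs _ _; rewrite iterD_cst0 normr0 !mulr_ge0 ?exprn_ge0 ?ler0n.
Qed.

Lemma bnd_null M K (rho : R) f g (C : R) : smooth f -> smooth g ->
  nullK p q K (fsub f g) -> bnd M K rho g C -> bnd M K rho f C.
Proof.
move=> sf sg n bg x vs Kx uvs; have := n vs x Kx; rewrite iterD_fsub//.
by move/subr0_eq->; exact: bg.
Qed.

(** The order zero part of a bound; it keeps the image of [K] inside a ball on which [f] is
    controlled. *)
Lemma bnd_norm M K (rho : R) f (C : R) x : M 0%N = 1 ->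
  bnd M K rho f C -> K x -> `|f x| <= C.
Proof. by move=> M0 bf Kx; have := bf x [::] Kx isT; rewrite /= M0 expr0 !mulr1. Qed.

Section Wnorm.
Variables (M : nat -> R) (K : set 'rV[R]_p) (rho : R).
Hypotheses (rho0 : 0 < rho) (Mp : forall k, 0 < M k).

Lemma wnorm_le_bnd f (C : R) : (wnorm p q M K rho f <= C%:E)%E <-> bnd M K rho f C.
Proof.
have W0 n : 0 < n`!%:R * rho ^+ n * M n by rewrite !mulr_gt0 ?exprn_gt0 ?ltr0n ?fact_gt0.
split=> [H x vs Kx uvs|bf].
  rewrite -ler_pdivrMr// -lee_fin; apply: le_trans H.
  by apply: ereal_sup_ubound; exists x, vs.
apply: ge_ereal_sup => _ [x [vs [Kx uvs ->]]].
by rewrite lee_fin ler_pdivrMr//; exact: bf.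
Qed.

Lemma wnorm_lt_bnd f (C : R) : (wnorm p q M K rho f < C%:E)%E -> bnd M K rho f C.
Proof. by move=> /ltW/wnorm_le_bnd. Qed.

Lemma bnd_wnorm_lt f (C C' : R) : C < C' -> bnd M K rho f C ->
  (wnorm p q M K rho f < C'%:E)%E.
Proof. by move=> CC /wnorm_le_bnd/le_lt_trans; apply; rewrite lte_fin. Qed.

Lemma bnd_wnorm_fin f (C : R) : bnd M K rho f C -> (wnorm p q M K rho f < +oo)%E.
Proof. by move=> /wnorm_le_bnd/le_lt_trans; apply; rewrite ltry. Qed.

Lemma wnorm_fin_bnd f : (wnorm p q M K rho f < +oo)%E ->
  exists2 C : R, 0 <= C & bnd M K rho f C.
Proof.
move=> H; have H' : (wnorm p q M K rho f <= `|fine (wnorm p q M K rho f)|%:E)%E.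
  by case: (wnorm _ _ _ _ _ _) H => [a| |]//= _; rewrite ?lee_fin ?ler_norm// leNye.
exists `|fine (wnorm p q M K rho f)| => //; exact/wnorm_le_bnd.
Qed.

End Wnorm.

End BoundAlgebra.

(** * Uniform continuity of the derivatives of the outer map *)

Section Modulus.
Variables (R : realType) (q r : nat).

(** Balls replace the image g(K): one ball serves all maps near g, and a slightly larger one
    contains the segments on which the mean value theorem is used. *)
Definition cball n (rad : R) : set 'rV[R]_n := [set y | `|y| <= rad].

Lemma compact_cball n (rad : R) : compact (@cball n rad).
Proof.
apply: bounded_closed_compact.
  exists rad; split; first exact: num_real.
  by move=> z /ltW rz y; rewrite /cball /= => /le_trans; exact.
rewrite (_ : cball _ = (fun y : 'rV[R]_n => `|y|) @^-1` [set x | x <= rad])//.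
by apply: closed_comp => [y _|]; [exact: norm_continuous|exact: closed_le].
Qed.

Lemma exists_pow2_ge (c : R) : exists n : nat, c <= 2 ^+ n.
Proof.
exists (Num.bound `|c|); apply: le_trans (ler_norm _) _.
apply: le_trans (ltW (archi_boundP (normr_ge0 c))) _.
by rewrite -natrX ler_nat ltnW// ltn_expl.
Qed.

(* No relation between [M k] and [M k.+1] is available, so doubling the radius
   makes the derivatives of high order negligible, and the mean value theorem is
   only used for the finitely many remaining orders. *)
Lemma derivative_modulus (f : 'rV[R]_q -> 'rV[R]_r) (M : nat -> R) (rad s F eta : R) :
  (forall j, 0 < M j) -> 0 < s -> 0 <= F -> 0 < eta -> smooth f ->
  bnd M (cball (rad + 1)) s f F ->
  exists2 d : R, 0 < d & forall y y', `|y| <= rad -> `|y'| <= rad -> `|y' - y| <= d ->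
    forall us, unit_vecs us -> `|iterD f us y' - iterD f us y| <=
      eta * ((size us)`!%:R * (2 * s) ^+ size us * M (size us)).
Proof.
move=> Mp s0 F0 eta0 sf bf.
(* From order [J] on, 2 F <= eta 2^j, so the triangle inequality suffices. *)
have [J HJ] := exists_pow2_ge (2 * F / eta).
pose w j : R := j`!%:R * s ^+ j * M j.
have w0 j : 0 < w j by rewrite !mulr_gt0 ?exprn_gt0 ?ltr0n ?fact_gt0.
(* This is the ratio of the mean value bound at order [j] to the target. [S] exceeds it for all j <
   J; as S >= 1, the distance 1/S also keeps the segment within the ball of radius rad + 1. *)
pose c j := F * w j.+1 / (eta * w j).
have Fw j : 0 <= F * w j := mulr_ge0 F0 (ltW (w0 j)).
have ew j : 0 < eta * w j := mulr_gt0 eta0 (w0 j).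
have c0 j : 0 <= c j := divr_ge0 (Fw _) (ltW (ew _)).
pose S := 1 + \sum_(j < J) c j.
have S1 : 1 <= S by rewrite lerDl sumr_ge0.
exists S^-1; first by rewrite invr_gt0 (lt_le_trans ltr01).
move=> y y' yr yr' yd us uus; set j := size us.
rewrite exprMn [leRHS](_ : _ = eta * 2 ^+ j * w j); last by rewrite /w; ring.
have [jJ|Jj] := ltnP j J; last first.
  apply: le_trans (ler_normB _ _) _.
  apply: le_trans (_ : _ <= F * w j + F * w j) _.
    by rewrite lerD//; apply: bf => //; rewrite /cball /= (le_trans yr, le_trans yr')// lerDl.
  rewrite -mulrDl ler_wpM2r ?(ltW (w0 _))// -ler_pdivrMl// mulrC.
  rewrite -[F]mul1r -mulrDl; apply: le_trans HJ _.
  by rewrite ler_weXn2l// ler1n.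
have yd1 : `|y' - y| <= 1 by rewrite (le_trans yd)// invf_le1// (lt_le_trans ltr01).
have := @mean_value_bound R _ r (iterD f us) y (y' - y) 0 1 (F * w j.+1 * `|y' - y|)
  (fun z => @smooth_derivable R q r f us z (y' - y) sf).
rewrite scale1r scaler0 subr0 [y + _]addrC subrK normr1 mul1r => H.
apply: le_trans (H _) _ => [t t1|].
  rewrite subr0.
  apply: (@multilin_head_bound R q r (fun ws => iterD f ws (y + t *: (y' - y)))
    (F * w j.+1) (y' - y) us (multilin_iterD _ sf)) => u u1.
  have -> : j.+1 = size (u :: us) by [].
  apply: bf => /=; last by rewrite u1.
  rewrite /cball /= (le_trans (ler_normD _ _))// lerD// normrZ.
  by rewrite -[leRHS]mulr1 ler_pM.
apply: le_trans (_ : _ <= F * w j.+1 * S^-1) _.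
  by rewrite ler_wpM2l.
apply: le_trans (_ : _ <= eta * w j) _; last first.
  by rewrite mulrAC ler_peMr ?(ltW (ew _))// -natrX ler1n expn_gt0.
rewrite ler_pdivrMr ?(lt_le_trans ltr01)// [leRHS]mulrC -ler_pdivrMr//.
rewrite -/(c j) /S (bigD1 (Ordinal jJ))//= addrCA lerDl addr_ge0// sumr_ge0//.
Qed.

End Modulus.

Section CompositionContinuity.
Variables (R : realType) (p q r : nat).

(** Half of [e] pays for the base point and half for the arguments. The 4 combines the doublings in
    [derivative_modulus] and [comp_diff_bnd]. The choice of [d] is uniform in [g] and [g'], as the
    Roumieu case requires. *)
Lemma comp_diff_small (f : 'rV[R]_q -> 'rV[R]_r) (M : nat -> R)
    (K : set 'rV[R]_p) (rad s sig F G e : R) :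
  M 0%N = 1 -> (forall j, 0 < M j) -> 0 < s -> 0 <= sig -> 0 <= F -> 1 <= G -> 0 < e ->
  smooth f -> bnd M (cball (rad + 1)) s f F ->
  exists2 d : R, 0 < d & forall g g' : 'rV[R]_p -> 'rV[R]_q, smooth g -> smooth g' ->
    (forall x, K x -> `|g x| <= rad) -> (forall x, K x -> `|g' x| <= rad) ->
    bnd M K sig g G -> bnd M K sig g' G -> bnd M K sig (fsub g' g) d ->
    bnd (circ M) K (sig * (2 + 4 * s * G)) (fsub (f \o g') (f \o g)) e.
Proof.
move=> M0 Mp s0 sig0 F0 G1 e0 sf bf.
have e20 : 0 < e / 2 by rewrite divr_gt0.
have [d1 d10 Hd1] := derivative_modulus Mp s0 F0 e20 sf bf.
(* F + 1 is positive even when F = 0. *)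
pose d2 := e / 2 / (F + 1).
have F1 : 0 < F + 1 by rewrite ltr_wpDl.
have d20 : 0 < d2 by rewrite divr_gt0.
exists (Num.min d1 d2); first by rewrite lt_min d10.
move=> g g' sg sg' Kg Kg' bg bg' bd.
have md0 : 0 <= Num.min d1 d2 by rewrite le_min !ltW.
have -> : 4 * s * G = 2 * (2 * s) * G by ring.
have bf2 : bnd M (cball (rad + 1)) (2 * s) f F.
  apply: bnd_mono bf => //; first exact: ltW.
    by rewrite ler_peMl// ?ltW// ltr1n.
  by move=> k; exact: ltW.
have := @comp_diff_bnd R p q r f g g' M K (cball (rad + 1)) (2 * s) sig F G (e / 2)
  (Num.min d1 d2) M0 Mp _ sig0 F0 G1 (ltW e20) md0 sf sg sg' _ bf2 bg bg' bd _.
move=> /(_ _ _ _)/wrap[|||H].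
- by rewrite mulr_ge0// ltW.
- by move=> x /Kg; rewrite /cball /= => /le_trans; apply; rewrite lerDl.
- move=> x us Kx uus; apply: Hd1 => //; [exact: Kg|exact: Kg'|].
  have := bnd_norm M0 bd Kx; rewrite /Defs.fsub => /le_trans; apply.
  by rewrite ge_min lexx.
apply: bnd_mono H => //.
- by rewrite addr_ge0 ?mulr_ge0// ltW.
- rewrite [leRHS]splitr lerD2l.
  apply: le_trans (_ : _ <= (F + 1) * d2) _; last by rewrite /d2 mulrC divfK// gt_eqF.
  by rewrite ler_pM// ?lerDl// ge_min lexx orbT.
- by rewrite mulr_ge0// addr_ge0// !mulr_ge0 ?(ltW s0) ?(le_trans ler01 G1).
- by move=> k; exact: circ_ge0.
Qed.

End CompositionContinuity.

(** * The Beurling case *)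

Section Beurling.
Variable R : realType.

Lemma finite_min_pos n (d : 'I_n -> R) : (forall i, 0 < d i) ->
  exists2 e : R, 0 < e & forall i, e <= d i.
Proof.
move=> d0; pose S := 1 + \sum_i (d i)^-1.
have s0 i : 0 <= (d i)^-1 by rewrite invr_ge0 ltW.
have S0 : 0 < S by rewrite ltr_wpDr// sumr_ge0.
exists S^-1; first by rewrite invr_gt0.
move=> i; rewrite -[leRHS]invrK lef_pV2 ?posrE ?invr_gt0//.
by rewrite /S (bigD1 i)//= addrCA lerDl addr_ge0// sumr_ge0.
Qed.

Variables (p q r : nat).

(** The first summand is linear in f' - f and falls under [comp_bnd]; the second, with [f] fixed,
    falls under [comp_diff_small]. *)
Lemma fsub_comp_split (f f' : 'rV[R]_q -> 'rV[R]_r) (g g' : 'rV[R]_p -> 'rV[R]_q) :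
  fsub (f' \o g') (f \o g) =
  (fun y => (fsub f' f \o g') y + fsub (f \o g') (f \o g) y).
Proof. by apply/funext => y; rewrite /Defs.fsub /= addrA subrK. Qed.

(** * Estimates for a single seminorm of the target *)

Section Local.
Variables (N P : nat -> R) (K : set 'rV[R]_p) (A tau rho : R).
Variables (f : 'rV[R]_q -> 'rV[R]_r) (g : 'rV[R]_p -> 'rV[R]_q).
Hypotheses (N0 : N 0%N = 1) (Np : forall k, 0 < N k) (P0 : forall k, 0 <= P k).
Hypotheses (A0 : 0 < A) (tau0 : 0 < tau) (rho0 : 0 < rho).
Hypothesis NP : forall k, circ N k <= A * tau ^+ k * P k.
Hypotheses (sf : smooth f) (sg : smooth g).
Hypothesis bg : forall sig, 0 < sig -> exists2 G : R, 0 <= G & bnd N K sig g G.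
Hypothesis bf : forall rad s, 0 < s -> exists2 F : R, 0 <= F & bnd N (cball rad) s f F.

(** Starting from the radius rho / (3 tau) leaves room for a factor 3 = 2 + 1: once [G] is known,
    [s] is taken so small that the term added to 2 is at most 1. *)
Lemma bnd_circ_to (h : 'rV[R]_p -> 'rV[R]_r) (C s : R) : 0 <= C -> 0 <= s -> s <= 3 ->
  bnd (circ N) K (rho / (3 * tau) * s) h C -> bnd P K rho h (C * A).
Proof.
move=> C0 s0 s3 H.
have t0 : 0 < 3 * tau by rewrite mulr_gt0.
have r0 : 0 <= rho / (3 * tau) * s by rewrite mulr_ge0// divr_ge0// ltW.
apply: bnd_mono (bnd_wpreceq NP r0 C0 H) => //.
- by rewrite mulr_ge0// ltW.
- by rewrite mulr_ge0// ltW.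
rewrite (_ : _ * tau = rho * (s / 3)); last by field; rewrite gt_eqF.
by rewrite ler_piMr ?(ltW rho0)// ler_pdivrMr// mul1r.
Qed.

Lemma beurling_comp_bnd : exists C : R, bnd P K rho (f \o g) C.
Proof.
have t0 : 0 < 3 * tau by rewrite mulr_gt0.
have sig0 : 0 < rho / (3 * tau) by rewrite divr_gt0.
have [G G0 HG] := bg sig0.
have G1 : 0 < G + 1 by rewrite ltr_wpDl.
have s0 : 0 < (G + 1)^-1 by rewrite invr_gt0.
have [F F0 HF] := bf G s0.
exists (F * A).
apply: (bnd_circ_to F0 _ _ (comp_bnd (L := cball G) N0 Np (ltW s0) (ltW sig0) F0 G0 sf sg _ HF HG)).
- by rewrite addr_ge0// mulr_ge0// ltW.
- rewrite (_ : 3 = 2 + 1); last by ring.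
  by rewrite lerD2l mulrC ler_pdivrMr// mul1r lerDl.
- by move=> x; exact: (bnd_norm N0 HG).
Qed.

Lemma beurling_comp_continuity (e : R) : 0 < e ->
  exists sig rad s d : R, [/\ 0 < sig, 0 < s, 0 < d &
    forall g' f', smooth g' -> smooth f' ->
      bnd N K sig (fsub g' g) d -> bnd N (cball rad) s (fsub f' f) d ->
      bnd P K rho (fsub (f' \o g') (f \o g)) e].
Proof.
move=> e0.
have t0 : 0 < 3 * tau by rewrite mulr_gt0.
have sig0 : 0 < rho / (3 * tau) by rewrite divr_gt0.
have [G0 G00 HG] := bg sig0.
(* Perturbations of [g] will be bounded by 1, so [G] serves both [g] and [g']. *)
pose G := G0 + 1.
have G1 : 1 <= G by rewrite lerDr.
have Gp : 0 < G by rewrite (lt_le_trans ltr01).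
have s0 : 0 < (4 * G)^-1 by rewrite invr_gt0 mulr_gt0.
have [F F0 HF] := bf (G + 1) s0.
(* Passing from [circ N] to [P] costs [A], and two summands share [e]. *)
pose e' := e / (2 * A).
have e'0 : 0 < e' by rewrite divr_gt0// mulr_gt0.
have [d1 d10 Hd1] := comp_diff_small K N0 Np s0 (ltW sig0) F0 G1 e'0 sf HF.
pose d := Num.min 1 (Num.min d1 e').
have d0 : 0 < d by rewrite !lt_min ltr01 d10 e'0.
have dd1 : d <= d1 by rewrite !ge_min lexx orbT.
have de' : d <= e' by rewrite !ge_min lexx !orbT.
have dd : d <= 1 by rewrite !ge_min lexx.
have Np0 k := ltW (Np k).
exists (rho / (3 * tau)), (G + 1), (4 * G)^-1, d; split=> // g' f' sg' sf' bg' bf'.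
have bgG : bnd N K (rho / (3 * tau)) g G.
  by apply: bnd_mono HG => //; [rewrite lerDl|exact: ltW].
have bg'G : bnd N K (rho / (3 * tau)) g' G.
  rewrite (_ : g' = (fun y => g y + fsub g' g y)); last first.
    by apply/funext => y; rewrite /Defs.fsub addrC subrK.
  apply: bnd_mono (bnd_add sg (smooth_fsub sg' sg) HG bg') => //.
  - by rewrite addr_ge0// ltW.
  - by rewrite lerD2l.
  - exact: ltW.
have H1 : bnd P K rho (fsub f' f \o g') (e' * A).
  have bf1 : bnd N (cball G) (4 * G)^-1 (fsub f' f) e'.
    apply: bnd_mono bf' => //; rewrite ?ltW//.
    by move=> x; rewrite /cball /= => /le_trans; apply; rewrite lerDl.
  apply: (bnd_circ_to (ltW e'0) _ _ (comp_bnd (L := cball G) N0 Np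
    (ltW s0) (ltW sig0) (ltW e'0) (ltW Gp) (smooth_fsub sf' sf) sg' _ bf1 bg'G)).
  - by rewrite addr_ge0// mulr_ge0// ltW.
  - rewrite invfM -mulrA mulVf ?gt_eqF// mulr1; lra.
  - by move=> x; exact: (bnd_norm N0 bg'G).
have H2 : bnd P K rho (fsub (f \o g') (f \o g)) (e' * A).
  apply: (bnd_circ_to (ltW e'0) _ _ (Hd1 g g' sg sg' _ _ bgG bg'G _)).
  - by rewrite addr_ge0// !mulr_ge0// ltW.
  - rewrite (_ : 4 * (4 * G)^-1 * G = 1); first lra.
    by field; rewrite gt_eqF.
  - by move=> x; exact: (bnd_norm N0 bgG).
  - by move=> x; exact: (bnd_norm N0 bg'G).
  - by apply: bnd_mono bg' => //; exact: ltW.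
have -> : e = e' * A + e' * A by rewrite /e'; field; rewrite gt_eqF.
rewrite fsub_comp_split; apply: bnd_add => //.
- exact: (smooth_comp sg' (smooth_fsub sf' sf)).
- exact: (smooth_fsub (smooth_comp sg' sf) (smooth_comp sg sf)).
Qed.

End Local.

Variables (Lam : set R) (M : R -> nat -> R).
Hypotheses (wM : weight_matrix Lam M) (fdb : FdB_beurling Lam M).

Lemma weight0 l : Lam l -> M l 0%N = 1.
Proof. by move=> Ll; case: (wM.1 l Ll). Qed.

Lemma weight_gt0 l k : Lam l -> 0 < M l k.
Proof. by move=> Ll; case: (wM.1 l Ll) => _ /(_ k). Qed.

Lemma EB_bnd a b (h : 'rV[R]_a -> 'rV[R]_b) l K rho :
  EB Lam M a b h -> Lam l -> compact K -> 0 < rho ->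
  exists2 C : R, 0 <= C & bnd (M l) K rho h C.
Proof.
move=> [_ H] Ll cK r0; apply: wnorm_fin_bnd => //; last exact: H.
by move=> k; exact: weight_gt0.
Qed.

Lemma EB_comp g f : EB Lam M p q g -> EB Lam M q r f -> EB Lam M p r (f \o g).
Proof.
move=> Eg Ef.
split=> [|l K rho Ll cK r0].
  exact: (smooth_comp Eg.1 Ef.1).
have [m [Lm [A [tau [A0 [t0 NP]]]]]] := fdb Ll.
have [C HC] := @beurling_comp_bnd (M m) (M l) K A tau rho f g (weight0 Lm)
  (fun k => weight_gt0 k Lm) (fun k => ltW (weight_gt0 k Ll)) A0 t0 r0 NP Ef.1 Eg.1
  (fun sig s0 => EB_bnd Eg Lm cK s0)
  (fun rad s s0 => EB_bnd Ef Lm (@compact_cball R q rad) s0).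
by apply: bnd_wnorm_fin HC => // k; exact: weight_gt0.
Qed.

Lemma EB_comp_continuous g f N : EB Lam M p q g -> EB Lam M q r f ->
  EB_nbhs Lam M p r (f \o g) N ->
  exists N1 N2, [/\ EB_nbhs Lam M p q g N1, EB_nbhs Lam M q r f N2 &
    forall g' f', EB Lam M p q g' -> EB Lam M q r f' ->
      N1 g' -> N2 f' -> N (f' \o g')].
Proof.
move=> Eg Ef [n [ls [Ks [rhos [eps [Lls cKs rhos0 eps0 HN]]]]]].
have /choice[ms Hms] i := fdb (Lls i).
have Lms i := (Hms i).1.
(* [bnd] is a non-strict inequality; aiming at eps / 2 makes it strict. *)
have e20 : 0 < eps / 2 by rewrite divr_gt0.
have H i : exists sig rad s d : R, [/\ 0 < sig, 0 < s, 0 < d &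
    forall g' f', smooth g' -> smooth f' ->
      bnd (M (ms i)) (Ks i) sig (fsub g' g) d -> bnd (M (ms i)) (cball rad) s (fsub f' f) d ->
      bnd (M (ls i)) (Ks i) (rhos i) (fsub (f' \o g') (f \o g)) (eps / 2)].
  have [Lm [A [tau [A0 [t0 NP]]]]] := Hms i.
  exact: (@beurling_comp_continuity (M (ms i)) (M (ls i)) (Ks i) A tau (rhos i) f g (weight0 Lm)
  (fun k => weight_gt0 k Lm) (fun k => ltW (weight_gt0 k (Lls i))) A0 t0 (rhos0 i) NP Ef.1 Eg.1
  (fun sig s0 => EB_bnd Eg Lm (cKs i) s0)
  (fun rad s s0 => EB_bnd Ef Lm (@compact_cball R q rad) s0) _ e20).
have /choice[sig /choice[rad /choice[s /choice[d Hd]]]] := H.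
have [dm dm0 dmd] : exists2 e : R, 0 < e & forall i, e <= d i.
  by apply: finite_min_pos => i; case: (Hd i).
exists [set h | forall i, (wnorm p q (M (ms i)) (Ks i) (sig i) (fsub h g) < dm%:E)%E].
exists [set h | forall i, (wnorm q r (M (ms i)) (cball (rad i)) (s i) (fsub h f) < dm%:E)%E].
split.
- by exists n, ms, Ks, sig, dm; split=> // i; case: (Hd i).
- exists n, ms, (fun i => cball (rad i)), s, dm; split=> // i; last by case: (Hd i).
  exact: compact_cball.
move=> g' f' Eg' Ef' /= H1 H2; apply: HN => [|i].
  exact: EB_comp.
have [sig0 s0 d0 Hi] := Hd i.
have Mp j k : 0 < M (ms j) k by exact: weight_gt0.
apply: (@bnd_wnorm_lt _ _ _ _ _ _ _ _ _ (eps / 2)) => //.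
- by move=> k; exact: weight_gt0.
- by rewrite ltr_pdivrMr// ltr_pMr// ltr1n.
apply: Hi; [exact: Eg'.1|exact: Ef'.1| |].
- have := wnorm_lt_bnd sig0 (Mp i) (H1 i); apply: bnd_mono => //; rewrite ?ltW// => k; exact: ltW.
- have := wnorm_lt_bnd s0 (Mp i) (H2 i); apply: bnd_mono => //; rewrite ?ltW// => k; exact: ltW.
Qed.

End Beurling.

(** * The Roumieu case *)

Section CofinalSequence.
Variable R : realType.

(** A maximum gives a constant sequence. Otherwise a rational lies between any member and some
    larger one, so it is enough to pick a member above each rational that has one, and to take
    running maxima. *)
Lemma cofinal_sequence (Lam : set R) (l0 : R) : Lam l0 ->
  exists u : nat -> R, [/\ forall n, Lam (u n),
    forall m n, (m <= n)%N -> u m <= u n & forall l, Lam l -> exists n, l <= u n].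
Proof.
move=> L0.
have [[m [Lm Hm]]|nomax] := pselect (exists m, Lam m /\ forall l, Lam l -> l <= m).
  by exists (fun=> m); split=> // l /Hm; exists 0%N.
have Hv (n : nat) : exists l, Lam l /\ forall x : rat, unpickle n = Some x ->
    (exists2 l', Lam l' & ratr x <= l') -> ratr x <= l.
  case E : (unpickle n) => [x|]; last by exists l0.
  have [[l' Ll' xl]|nx] := pselect (exists2 l', Lam l' & ratr x <= l').
    by exists l'; split=> // y [<-].
  by exists l0; split=> // y [<-].
have [v Hv'] := choice Hv.
pose u := fix u n := if n is n'.+1 then Num.max (u n') (v n) else v 0%N.
have uS n : u n.+1 = Num.max (u n) (v n.+1) by [].
exists u; split.
- elim=> [|n IH]; first by case: (Hv' 0%N).
  by rewrite uS; case: leP => _ //; case: (Hv' n.+1).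
- move=> m n /subnK <-; elim: (n - m)%N => // k IH.
  by rewrite addSn uS le_max IH.
move=> l Ll.
have [l' Ll' ll'] : exists2 l', Lam l' & l < l'.
  apply: contrapT => H; apply: nomax; exists l; split=> // l' Ll'.
  by rewrite leNgt; apply/negP => ll'; apply: H; exists l'.
have [x] := rat_in_itvoo ll'; rewrite in_itv /= => /andP[lx xl'].
exists (pickle x); apply: le_trans (ltW lx) _.
have [_ /(_ x)] := Hv' (pickle x); rewrite pickleK => /(_ erefl) H.
apply: le_trans (H _) _; first by exists l' => //; exact: ltW.
by case: (pickle x) => // n; rewrite uS le_max lexx orbT.
Qed.

Lemma dominated_of_eventually (v w : nat -> R) k0 :
  (forall k, 0 <= v k) -> (forall k, 0 < w k) ->
  (forall k, (k0 <= k)%N -> v k <= w k) ->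
  exists2 C : R, 0 < C & forall k, v k <= C * w k.
Proof.
move=> v0 w0 H; pose S := \sum_(k < k0) v k / w k.
have t0 k : 0 <= v k / w k by rewrite divr_ge0// ltW.
have S0 : 0 <= S by rewrite sumr_ge0.
exists (1 + S); first by rewrite ltr_wpDr.
move=> k; have [kk|/H h] := ltnP k k0; last first.
  by apply: le_trans h _; rewrite ler_peMl ?lerDl// ltW.
rewrite -ler_pdivrMr// /S (bigD1 (Ordinal kk))//= addrCA lerDl addr_ge0// sumr_ge0//.
Qed.

End CofinalSequence.

(** * Sums of balls from successive steps *)

Section SumOfBalls.
Variables (R : realType) (p q : nat) (K : set 'rV[R]_p).
Variables (w : nat -> nat -> R) (rr : nat -> R) (delta : nat -> R).
Hypotheses (w_gt0 : forall n k, 0 < w n k) (rr_gt0 : forall n, 0 < rr n).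
Hypotheses (w_mono : forall n k, w n k <= w n.+1 k) (rr_mono : forall n, rr n <= rr n.+1).
Hypotheses (delta_gt0 : forall n, 0 < delta n) (delta_le : forall n, delta n <= 2^-1 ^+ n.+1).

Fixpoint ball_sum n : set ('rV[R]_p -> 'rV[R]_q) :=
  if n is n'.+1 then
    [set h | exists a b, [/\ ball_sum n' a, smooth b,
       bnd (w n') K (rr n') b (delta n') & h = (fun y => a y + b y)]]
  else [set (fun=> 0)].

Lemma ball_sum_smooth n h : ball_sum n h -> smooth h.
Proof.
elim: n h => [h ->|n IH h [a [b [/IH sa sb _ ->]]]]; first exact: smooth_cst0.
exact: smooth_add.
Qed.

(** The radii [delta i] are dominated by a geometric series with partial sums 1 - 2^-n, and a ball
    of an earlier step lies in the later ones. *)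
Lemma ball_sum_bnd n h : ball_sum n h -> bnd (w n) K (rr n) h (1 - 2^-1 ^+ n).
Proof.
have w0 m k := ltW (w_gt0 m k); have r0 m := ltW (rr_gt0 m).
elim: n h => [h ->|n IH h [a [b [Ua sb bb ->]]]].
  by apply: bnd_cst0 => //; rewrite expr0 subrr.
have := bnd_add (ball_sum_smooth Ua) sb (IH _ Ua) bb; apply: bnd_mono => //.
  by rewrite addr_ge0 ?(ltW (delta_gt0 _))// subr_ge0 exprn_ile1// invf_le1 ?ler1n.
apply: le_trans (lerD (lexx _) (delta_le n)) _.
rewrite exprS; lra.
Qed.

Lemma ball_sum0 n : ball_sum n (fun=> 0).
Proof.
elim: n => // n IH; exists (fun=> 0), (fun=> 0); split=> //.
- exact: smooth_cst0.
- by apply: bnd_cst0 => [||k]; exact: ltW.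
- by apply/funext => y; rewrite addr0.
Qed.

Lemma ball_sumS n h : ball_sum n h -> ball_sum n.+1 h.
Proof.
move=> Uh; exists h, (fun=> 0); split=> //.
- exact: smooth_cst0.
- by apply: bnd_cst0 => [||k]; exact: ltW.
- by apply/funext => y; rewrite addr0.
Qed.

Lemma ball_sum_mono m n h : (m <= n)%N -> ball_sum m h -> ball_sum n h.
Proof.
move=> /subnK <- Uh; elim: (n - m)%N => // k IH; rewrite addSn; exact: ball_sumS.
Qed.

Lemma ball_sum_absconvex n : absconvex p q (ball_sum n).
Proof.
elim: n => [a b -> -> s t _|n IH _ _ [a [b [Ua sb bb ->]]] [a' [b' [Ua' sb' bb' ->]]] s t st].
  by apply/funext => y; rewrite !scaler0 addr0.
exists (fun y => s *: a y + t *: a' y), (fun y => s *: b y + t *: b' y); split.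
- exact: IH.
- exact: smooth_lincomb.
- have := bnd_lincomb s t sb sb' bb bb'; have d0 := ltW (delta_gt0 n).
  apply: bnd_mono => //; rewrite ?(ltW (rr_gt0 _))// ?addr_ge0 ?mulr_ge0//.
    by rewrite -mulrDl ler_piMl.
  by move=> k; exact: ltW.
- by apply/funext => y; rewrite !scalerDr addrACA.
Qed.

(** A difference that vanishes on [K] to all orders lies in every ball, so it can be the next
    summand. *)
Lemma ball_sum_null n h a : ball_sum n a -> smooth h -> nullK p q K (fsub h a) ->
  ball_sum n.+1 h.
Proof.
move=> Ua sh nh; exists a, (fsub h a); split; first exact: Ua.
- exact: smooth_fsub sh (ball_sum_smooth Ua).
- move=> x vs Kx _; rewrite (nh vs x Kx) normr0.
  by rewrite !mulr_ge0 ?exprn_ge0 ?ler0n// ltW.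
- by apply/funext => y; rewrite /Defs.fsub addrC subrK.
Qed.

End SumOfBalls.

(** * Steps of the inductive limit and dominating weights *)

Section Roumieu.
Variables (R : realType) (Lam : set R) (M : R -> nat -> R).
Hypotheses (wM : weight_matrix Lam M) (fdb : FdB_roumieu Lam M).
Variable u : nat -> R.
Hypotheses (Lu : forall n, Lam (u n)) (u_mono : forall m n, (m <= n)%N -> u m <= u n).
Hypothesis u_cofinal : forall l, Lam l -> exists n, l <= u n.

(** One index drives both weight and radius; these steps are cofinal in the limit over both. *)
Definition step_bnd p q n (K : set 'rV[R]_p) (h : 'rV[R]_p -> 'rV[R]_q) (C : R) :=
  bnd (M (u n)) K n.+1%:R h C.

Lemma step_seq_gt0 n k : 0 < M (u n) k.
Proof. exact: (weight_gt0 wM). Qed.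

Lemma step_seq_ge0 n k : 0 <= M (u n) k.
Proof. exact/ltW/step_seq_gt0. Qed.

Lemma step_seq0 n : M (u n) 0%N = 1.
Proof. exact: (weight0 wM). Qed.

Lemma bnd_step p q l (m : nat) (K : set 'rV[R]_p) (h : 'rV[R]_p -> 'rV[R]_q) :
  Lam l -> exists n0, forall n C, (n0 <= n)%N -> 0 <= C ->
    bnd (M l) K m.+1%:R h C -> step_bnd n K h C.
Proof.
move=> Ll; have [n1 ln1] := u_cofinal Ll; exists (maxn n1 m) => n C.
rewrite geq_max => /andP[n1n mn] C0; apply: bnd_mono => //.
- by rewrite ler_nat ltnS.
- by move=> k; apply/ltW; exact: (weight_gt0 wM).
- by move=> k; apply: wM.2 => //; apply: le_trans ln1 (u_mono _).
Qed.

Lemma step_mono p q n m (K : set 'rV[R]_p) (h : 'rV[R]_p -> 'rV[R]_q) (C C' : R) :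
  (n <= m)%N -> 0 <= C -> C <= C' -> step_bnd n K h C -> step_bnd m K h C'.
Proof.
move=> nm C0 CC; apply: bnd_mono => //.
- by rewrite ler_nat ltnS.
- exact: step_seq_ge0.
- by move=> k; apply: wM.2 => //; exact: u_mono.
Qed.

Lemma FK_step p q (K : set 'rV[R]_p) (h : 'rV[R]_p -> 'rV[R]_q) : FK Lam M p q K h ->
  exists n0, exists2 C : R, 0 <= C & forall n, (n0 <= n)%N -> step_bnd n K h C.
Proof.
move=> [_ [l [m [Ll]]]] /wnorm_fin_bnd[//|k|C C0 hC]; first exact: (weight_gt0 wM).
have [n0 H] := bnd_step m K h Ll.
by exists n0, C => // n nn0; exact: H.
Qed.

Lemma step_FK p q n (K : set 'rV[R]_p) (h : 'rV[R]_p -> 'rV[R]_q) (C : R) :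
  smooth h -> step_bnd n K h C -> FK Lam M p q K h.
Proof.
move=> sh H; split=> //; exists (u n), n; split=> //.
by apply: bnd_wnorm_fin H => // k; exact: step_seq_gt0.
Qed.

(** [n'] and [A] are chosen before the map and the compact set, so one pair handles all the
    increments of a composition. *)
Lemma circ_step n (rho : R) : 0 <= rho -> exists n' (A : R), 0 < A /\
  forall p q (K : set 'rV[R]_p) (h : 'rV[R]_p -> 'rV[R]_q) (C : R), 0 <= C ->
    bnd (circ (M (u n))) K rho h C -> step_bnd n' K h (C * A).
Proof.
move=> r0; have [l [Ll [A [tau [A0 [t0 HA]]]]]] := fdb (Lu n).
have [n1 ln1] := u_cofinal Ll.
pose m := Num.bound (rho * tau).
have rt0 : 0 <= rho * tau by rewrite mulr_ge0// ltW.
exists (maxn n1 m), A; split=> // p q K h C C0 H.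
apply: bnd_mono (bnd_wpreceq HA r0 C0 H) => //.
- by rewrite mulr_ge0// ltW.
- apply: le_trans (ltW (archi_boundP rt0)) _.
  by rewrite ler_nat leqW// leq_maxr.
- by move=> k; apply/ltW; exact: (weight_gt0 wM).
- by move=> k; apply: wM.2 => //; apply: le_trans ln1 (u_mono _); rewrite leq_maxl.
Qed.

Definition absorbing p q (K : set 'rV[R]_p) (A : set ('rV[R]_p -> 'rV[R]_q)) :=
  forall n, exists2 e : R, 0 < e & forall h, smooth h -> step_bnd n K h e -> A h.

Lemma FK_nbhs0_absorbing p q (K : set 'rV[R]_p) W : FK_nbhs0 Lam M p q K W ->
  exists A, [/\ absconvex p q A, absorbing K A & forall h, A h -> smooth h -> W h].
Proof.
move=> [A [AFK Aconv Aabs AW]]; exists A; split=> //.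
- move=> n; have [e [e0 He]] := Aabs (u n) n (Lu n).
  exists (e / 2) => [|h sh H]; first by rewrite divr_gt0.
  apply: He => //; apply: bnd_wnorm_lt H => //; first exact: step_seq_gt0.
  by rewrite ltr_pdivrMr// ltr_pMr// ltr1n.
- move=> h Ah sh; apply: (AW h) => // vs x Kx.
  by rewrite iterD_fsub// subrr.
Qed.

Lemma absorbing_FK_nbhs0 p q (K : set 'rV[R]_p) (A : set ('rV[R]_p -> 'rV[R]_q)) :
  A `<=` FK Lam M p q K -> absconvex p q A -> absorbing K A ->
  (forall a h, A a -> smooth h -> nullK p q K (fsub h a) -> A h) ->
  FK_nbhs0 Lam M p q K A.
Proof.
move=> AFK Aconv Aabs An; exists A; split=> // l m Ll.
have [n1 ln1] := u_cofinal Ll.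
have [e e0 He] := Aabs (maxn n1 m).
exists e; split=> // h sh hw; apply: He => //.
have := wnorm_lt_bnd _ _ hw; move=> /(_ _ _)/wrap[//|k|].
  exact: (weight_gt0 wM).
apply: bnd_mono => //; rewrite ?(ltW e0)//.
- by rewrite ler_nat ltnS leq_maxr.
- by move=> k; apply/ltW; exact: (weight_gt0 wM).
- by move=> k; apply: wM.2 => //; apply: le_trans ln1 (u_mono _); rewrite leq_maxl.
Qed.

(** The radius is moved into the weight, so that one sequence can follow different steps at
    different orders. *)
Definition step_weight n k : R := n.+1%:R ^+ k * M (u n) k.

Lemma step_weight_gt0 n k : 0 < step_weight n k.
Proof. by rewrite mulr_gt0 ?exprn_gt0 ?ltr0n ?step_seq_gt0. Qed.

Lemma step_weight_mono n m k : (n <= m)%N -> step_weight n k <= step_weight m k.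
Proof.
move=> nm; rewrite ler_pM ?exprn_ge0 ?ler0n ?step_seq_ge0//.
  by rewrite lerXn2r ?nnegrE ?ler0n// ler_nat ltnS.
by apply: wM.2 => //; exact: u_mono.
Qed.

Lemma step_bndE p q n (K : set 'rV[R]_p) (h : 'rV[R]_p -> 'rV[R]_q) (C : R) :
  step_bnd n K h C <-> bnd (step_weight n) K 1 h C.
Proof.
have E k : k`!%:R * 1 ^+ k * step_weight n k = k`!%:R * n.+1%:R ^+ k * M (u n) k.
  by rewrite expr1n mulr1 mulrA.
by split=> H x vs Kx uvs; have := H x vs Kx uvs; rewrite E.
Qed.

Definition dominating (w : nat -> R) := (forall k, 0 < w k) /\
  forall n, exists2 C : R, 0 < C & forall k, step_weight n k <= C * w k.

(** Every step embeds continuously into the space of weight [w], hence the unit ball of the latter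
    traces a neighbourhood of 0. *)
Lemma dominating_nbhs p q (K : set 'rV[R]_p) w : dominating w ->
  FK_nbhs0 Lam M p q K [set h | FK Lam M p q K h /\ bnd w K 1 h 1].
Proof.
move=> [w0 Hw]; apply: absorbing_FK_nbhs0 => [h []//| | |].
- move=> a b [Fa ba] [Fb bb] s t st; split.
    have [na [Ca Ca0 Ha]] := FK_step Fa; have [nb [Cb Cb0 Hb]] := FK_step Fb.
    apply: (step_FK (n := maxn na nb) (C := `|s| * Ca + `|t| * Cb)).
      exact: smooth_lincomb Fa.1 Fb.1.
    by apply: bnd_lincomb; [exact: Fa.1|exact: Fb.1|
      exact: Ha (leq_maxl _ _)|exact: Hb (leq_maxr _ _)].
  have := bnd_lincomb s t Fa.1 Fb.1 ba bb; apply: bnd_mono => //.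
    by rewrite !mulr1.
  by move=> k; exact: ltW.
- move=> n; have [C C0 HC] := Hw n; exists C^-1; first by rewrite invr_gt0.
  move=> h sh hb; split; first exact: step_FK hb.
  move=> x vs Kx uvs; apply: le_trans (hb x vs Kx uvs) _.
  rewrite mul1r expr1n mulr1 -mulrA mulrCA ler_wpM2l ?ler0n//.
  by rewrite mulrC ler_pdivrMr// [leRHS]mulrC; exact: HC.
- move=> a h [Fa ba] sh nh; have [n [C C0 HC]] := FK_step Fa; split.
    exact: step_FK (bnd_null sh Fa.1 nh (HC n (leqnn n))).
  exact: bnd_null sh Fa.1 nh ba.
Qed.

Lemma dominating_diag : dominating (fun k => step_weight k k).
Proof.
split=> [k|n]; first exact: step_weight_gt0.
apply: (dominated_of_eventually (k0 := n)) => [k|k|k nk].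
- exact/ltW/step_weight_gt0.
- exact: step_weight_gt0.
- exact: step_weight_mono.
Qed.

Lemma dominatingZ (c : R) w : 0 < c -> dominating w -> dominating (fun k => c * w k).
Proof.
move=> c0 [w0 Hw]; split=> [k|n]; first by rewrite mulr_gt0.
have [C C0 HC] := Hw n; exists (C / c) => [|k]; first by rewrite divr_gt0.
by rewrite mulrA divfK ?HC// gt_eqF.
Qed.

(* If no single step bounded the sequence, one could choose orders
   [k_0 < k_1 < ...] such that the [k_(i+1)]-st derivative of some late term violates
   the [i]-th step; the weight equal to [step_weight i] on [k_i < k <= k_(i+1)]
   dominates every step but fails to bound the sequence. *)
Lemma step_bounded p q (K : set 'rV[R]_p) (hs : nat -> 'rV[R]_p -> 'rV[R]_q) :
  (forall w, dominating w -> exists n0, forall n, (n0 <= n)%N -> bnd w K 1 (hs n) 1) ->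
  exists i n0, exists2 C : R, 0 < C & forall n, (n0 <= n)%N -> bnd (step_weight i) K 1 (hs n) C.
Proof.
move=> Hdom; apply: contrapT => Hno.
have H i k0 : exists nk : nat * nat, [/\ (i <= nk.1)%N, (k0 < nk.2)%N &
    exists x vs, [/\ K x, unit_vecs vs, size vs = nk.2 &
      nk.2`!%:R * step_weight i nk.2 < `|iterD (hs nk.1) vs x|]].
  have [n1 Hn1] := Hdom _ dominating_diag.
  (* Orders up to [k0] are already controlled through the diagonal weight, so a violation of step
     [i] must occur beyond [k0]. *)
  pose v k := if (k <= k0)%N then step_weight k k else 0.
  have [C C0 HC] : exists2 C : R, 0 < C & forall k, v k <= C * step_weight i k.
    apply: (dominated_of_eventually (k0 := k0.+1)) => [k|k|k k0k].
    - by rewrite /v; case: ifP => // _; exact/ltW/step_weight_gt0.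
    - exact: step_weight_gt0.
    - by rewrite /v leqNgt k0k /=; exact/ltW/step_weight_gt0.
  apply: contrapT => Hn; apply: Hno; exists i, (maxn n1 i), (C + 1).
    by rewrite ltr_wpDr.
  move=> n; rewrite geq_max => /andP[n1n iN] x vs Kx uvs.
  rewrite expr1n mulr1.
  have sw0 := ltW (step_weight_gt0 i (size vs)).
  have [kk|kk] := leqP (size vs) k0.
    apply: le_trans (Hn1 n n1n x vs Kx uvs) _; rewrite mul1r expr1n mulr1 [leRHS]mulrCA.
    rewrite ler_wpM2l ?ler0n//; have := HC (size vs); rewrite /v kk.
    by move=> /le_trans; apply; rewrite ler_wpM2r// lerDl.
  rewrite leNgt; apply/negP => Hlt; apply: Hn; exists (n, size vs); split=> //=.
  exists x, vs; split=> //; apply: le_lt_trans Hlt.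
  by rewrite ler_peMl ?(mulr_ge0 (ler0n _ _) sw0)// lerDr ltW.
have {H} [nk Hnk] := choice (fun ik : nat * nat => H ik.1 ik.2).
pose kap := fix kap i := if i is i'.+1 then (nk (i', kap i')).2 else 0%N.
have kapS i : kap i.+1 = (nk (i, kap i)).2 by [].
have kap_lt i : (kap i < kap i.+1)%N by rewrite kapS; case: (Hnk (i, kap i)).
have kap_mono : {mono kap : i j / (i <= j)%N}.
  apply: leq_mono; apply: homo_ltn => //; exact: ltn_trans.
have kap_ge i : (i <= kap i)%N.
  by elim: i => // i IH; exact: leq_ltn_trans IH (kap_lt i).
(* The largest i with kap i < k, and 0 for k = 0. It equals i at k = kap (i + 1), where step i is
   violated. *)
pose iota' k := (\max_(i < k.+1 | (kap i < k)%N) i)%N.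
have iota_ge i k : (kap i < k)%N -> (i <= iota' k)%N.
  move=> ik; have ik' : (i < k.+1)%N by rewrite ltnS (leq_trans (kap_ge i))// ltnW.
  exact: (@leq_bigmax_cond _ (fun i : 'I_k.+1 => (kap i < k)%N)
    (fun i : 'I_k.+1 => val i) (Ordinal ik')).
have iota_kap i : iota' (kap i.+1) = i.
  apply/eqP; rewrite eqn_leq iota_ge// andbT.
  apply/bigmax_leqP => j; rewrite ltnNge kap_mono -ltnNge ltnS //.
pose w k := step_weight (iota' k) k.
have dw : dominating w.
  split=> [k|n]; first exact: step_weight_gt0.
  apply: (dominated_of_eventually (k0 := (kap n).+1)) => [k|k|k nk'].
  - exact/ltW/step_weight_gt0.
  - exact: step_weight_gt0.
  - by apply: step_weight_mono; exact: iota_ge.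
have [n0 Hn0] := Hdom _ dw.
have [/= n0n _ [x [vs [Kx uvs svs]]]] := Hnk (n0, kap n0).
have := Hn0 _ n0n x vs Kx uvs; rewrite mul1r expr1n mulr1 svs /w -kapS iota_kap.
by move=> /le_lt_trans h /h; rewrite ltxx.
Qed.

(** A sequence bounded in step [i] gains 2^-k at order k when the radius doubles, which makes the
    high orders small. The finitely many low orders are made small by a small multiple of the
    diagonal weight. *)
Lemma step_convergence p q (K : set 'rV[R]_p) (hs : nat -> 'rV[R]_p -> 'rV[R]_q) :
  (forall w, dominating w -> exists n0, forall n, (n0 <= n)%N -> bnd w K 1 (hs n) 1) ->
  exists i, forall e : R, 0 < e -> exists n0, forall n, (n0 <= n)%N -> step_bnd i K (hs n) e.
Proof.
move=> Hdom; have [i [n1 [C C0 HC]]] := step_bounded Hdom.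
(* Step n has radius n + 1, and (2 i + 1) + 1 is twice i + 1. *)
exists (i.*2.+1) => e e0.
have [J HJ] := exists_pow2_ge (C / e).
pose t k := 2 ^+ k * step_weight i k.
have t0 k : 0 < t k by rewrite mulr_gt0 ?exprn_gt0 ?step_weight_gt0.
have tle k : t k <= step_weight i.*2.+1 k.
  rewrite /t /step_weight mulrA -exprMn ler_pM ?exprn_ge0 ?mulr_ge0 ?ler0n ?step_seq_ge0//.
    rewrite lerXn2r ?nnegrE ?mulr_ge0 ?ler0n// -natrM ler_nat.
    by rewrite mul2n doubleS.
  by apply: wM.2 => //; apply: u_mono; rewrite leqW// -addnn leq_addr.
pose v k := if (k < J)%N then step_weight k k else 0.
have [D D0 HD] : exists2 D : R, 0 < D & forall k, v k <= D * t k.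
  apply: (dominated_of_eventually (k0 := J)) => // [k|k Jk].
  - by rewrite /v; case: ifP => // _; exact/ltW/step_weight_gt0.
  - by rewrite /v ltnNge Jk /=; exact: ltW.
have [n2 Hn2] := Hdom _ (dominatingZ (divr_gt0 e0 D0) dominating_diag).
exists (maxn n1 n2) => n; rewrite geq_max => /andP[n1n n2n].
apply/step_bndE => x vs Kx uvs; rewrite expr1n mulr1.
apply: le_trans (_ : _ <= e * ((size vs)`!%:R * t (size vs))) _; last first.
  by rewrite ler_wpM2l ?(ltW e0)// ler_wpM2l ?ler0n.
have [kJ|Jk] := ltnP (size vs) J.
  apply: le_trans (Hn2 n n2n x vs Kx uvs) _; rewrite mul1r expr1n mulr1 [leRHS]mulrCA.
  rewrite ler_wpM2l ?ler0n// mulrAC -mulrA ler_wpM2l ?(ltW e0)//.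
  by rewrite ler_pdivrMr// mulrC; have := HD (size vs); rewrite /v kJ.
apply: le_trans (HC n n1n x vs Kx uvs) _; rewrite expr1n mulr1 /t.
rewrite mulrCA [leRHS]mulrCA ler_wpM2l ?ler0n// [leRHS]mulrA.
rewrite ler_wpM2r ?(ltW (step_weight_gt0 _ _))// mulrC -ler_pdivrMr//.
by apply: le_trans HJ _; rewrite ler_weXn2l// ler1n.
Qed.

Lemma ER_seq_step p q (hs : nat -> 'rV[R]_p -> 'rV[R]_q) h (K : set 'rV[R]_p) :
  compact K ->
  (forall N, ER_nbhs Lam M p q h N -> exists n0, forall n, (n0 <= n)%N -> N (hs n)) ->
  exists i, forall e : R, 0 < e ->
    exists n0, forall n, (n0 <= n)%N -> step_bnd i K (fsub (hs n) h) e.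
Proof.
move=> cK Hc; apply: step_convergence => w dw.
have [|n0 Hn0] := Hc [set h' | bnd w K 1 (fsub h' h) 1].
  exists 1%N, (fun=> K), (fun=> [set h | FK Lam M p q K h /\ bnd w K 1 h 1]).
  split=> // [_|h' Eh' /(_ ord0)[]//]; exact: dominating_nbhs.
by exists n0.
Qed.

(** * Composition in Roumieu spaces *)

Section Composition.
Variables (p q r : nat).

Lemma ER_comp (f : 'rV[R]_q -> 'rV[R]_r) (g : 'rV[R]_p -> 'rV[R]_q) :
  ER Lam M q r f -> ER Lam M p q g -> ER Lam M p r (f \o g).
Proof.
move=> [sf Ff] [sg Fg]; have sfg := smooth_comp sg sf; split=> // K cK.
have [ng [G G0 HG]] := FK_step (Fg K cK).
have [nf [F F0 HF]] := FK_step (Ff _ (@compact_cball R q G)).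
pose n := maxn ng nf.
have bG := HG n (leq_maxl _ _); have bF := HF n (leq_maxr _ _).
have n0 : 0 <= n.+1%:R :> R by rewrite ler0n.
have rho0 : 0 <= n.+1%:R * (2 + n.+1%:R * G) by rewrite mulr_ge0// addr_ge0// mulr_ge0.
have [n' [A [A0 HA]]] := circ_step n rho0.
have H := comp_bnd (L := cball G) (step_seq0 n) (step_seq_gt0 n) n0 n0 F0 G0 sf sg _ bF bG.
apply: (step_FK sfg (HA _ _ _ _ _ F0 (H _))) => x.
exact: (bnd_norm (step_seq0 n) bG).
Qed.

(** The difference lands in A / c for a prescribed [c]. The bound of [f] in step [m] persists in
    every later step [n], so [F] need not change as [n] grows. *)
Lemma comp_diff_absorbed (f : 'rV[R]_q -> 'rV[R]_r) (K : set 'rV[R]_p)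
    (A : set ('rV[R]_p -> 'rV[R]_r)) n m (rad F G c : R) :
  absorbing K A -> smooth f -> 0 <= F -> 1 <= G -> 0 < c -> (m <= n)%N ->
  step_bnd m (cball (rad + 1)) f F ->
  exists2 d : R, 0 < d & forall g g' : 'rV[R]_p -> 'rV[R]_q, smooth g -> smooth g' ->
    (forall x, K x -> `|g x| <= rad) -> (forall x, K x -> `|g' x| <= rad) ->
    step_bnd n K g G -> step_bnd n K g' G -> step_bnd n K (fsub g' g) d ->
    A (fun y => c *: fsub (f \o g') (f \o g) y).
Proof.
move=> Aabs sf F0 G1 c0 mn bf.
have n0 : 0 <= n.+1%:R :> R by rewrite ler0n.
have G0 : 0 <= G by exact: le_trans G1.
have rho0 : 0 <= n.+1%:R * (2 + 4 * n.+1%:R * G) by rewrite mulr_ge0// addr_ge0// !mulr_ge0.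
have [n' [B [B0 HB]]] := circ_step n rho0.
have [e e0 He] := Aabs n'.
have e'0 : 0 < e / (c * B) by rewrite divr_gt0// mulr_gt0.
have bf' : bnd (M (u n)) (cball (rad + 1)) n.+1%:R f F := step_mono mn F0 (lexx F) bf.
have [d d0 Hd] := comp_diff_small K (step_seq0 n) (step_seq_gt0 n) (ltr0Sn R n) n0 F0 G1 e'0 sf bf'.
exists d => // g g' sg sg' Kg Kg' bg bg' bd.
have sd : smooth (fsub (f \o g') (f \o g)) := smooth_fsub (smooth_comp sg' sf) (smooth_comp sg sf).
apply: He; first exact: smooth_scale.
have := bnd_scale c sd (HB _ _ _ _ _ (ltW e'0) (Hd _ _ sg sg' Kg Kg' bg bg' bd)).
rewrite (gtr0_norm c0) (_ : c * (e / (c * B) * B) = e)//.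
by field; rewrite !gt_eqF.
Qed.

(* A 0-neighbourhood of the inductive limit contains a union of sums of balls
   [delta_0 B_0 + ... + delta_(n-1) B_(n-1)]; adding the summands one at a time,
   the increment of [f \o _] at step [n] is absorbed by [2^-(n+1) A]. *)
Lemma comp_left_continuous (f : 'rV[R]_q -> 'rV[R]_r) (g : 'rV[R]_p -> 'rV[R]_q) K W :
  ER Lam M q r f -> ER Lam M p q g -> compact K -> FK_nbhs0 Lam M p r K W ->
  exists V, FK_nbhs0 Lam M p q K V /\
    forall g', smooth g' -> V (fsub g' g) -> W (fsub (f \o g') (f \o g)).
Proof.
move=> [sf Ff] [sg Fg] cK /FK_nbhs0_absorbing[A [Aconv Aabs AW]].
have [ng [G0 G00 HG]] := FK_step (Fg K cK).
(* Sums of balls have bound below 1, so adding them to [g] never exceeds [G]. *)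
pose G := G0 + 1.
have G1 : 1 <= G by rewrite lerDr.
have [nf [F F0 HF]] := FK_step (Ff _ (@compact_cball R q (G + 1))).
pose N := maxn ng nf.
have bG n : step_bnd (N + n) K g G0.
  by apply: HG; rewrite (leq_trans (leq_maxl ng nf))// leq_addr.
have bF : step_bnd N (cball (G + 1)) f F by apply: HF; rewrite leq_maxr.
have Hd n : exists d : R, 0 < d /\ forall g g' : 'rV[R]_p -> 'rV[R]_q, smooth g -> smooth g' ->
    (forall x, K x -> `|g x| <= G) -> (forall x, K x -> `|g' x| <= G) ->
    step_bnd (N + n) K g G -> step_bnd (N + n) K g' G -> step_bnd (N + n) K (fsub g' g) d ->
    A (fun y => 2 ^+ n.+1 *: fsub (f \o g') (f \o g) y).
  have c0 : 0 < 2 ^+ n.+1 :> R by rewrite exprn_gt0.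
  have [d d0 H] := comp_diff_absorbed Aabs sf F0 G1 c0 (leq_addr n N) bF.
  by exists d.
have {Hd} [d Hd] := choice Hd.
pose delta n := Num.min (d n) (2^-1 ^+ n.+1).
have delta_gt0 n : 0 < delta n by rewrite lt_min (Hd n).1 exprn_gt0.
have delta_le n : delta n <= 2^-1 ^+ n.+1 by rewrite ge_min lexx orbT.
have delta_d n : delta n <= d n by rewrite ge_min lexx.
pose w n := M (u (N + n)); pose rr n : R := (N + n).+1%:R.
have w_gt0 n k : 0 < w n k by exact: step_seq_gt0.
have rr_gt0 n : 0 < rr n by rewrite ltr0n.
have w_mono n k : w n k <= w n.+1 k.
  by apply: wM.2 => //; apply: u_mono; rewrite addnS.
have rr_mono n : rr n <= rr n.+1 by rewrite ler_nat addnS.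
pose U := ball_sum (q := q) K w rr delta.
have Ubnd n h : U n h -> step_bnd (N + n) K h (1 - 2^-1 ^+ n).
  exact: ball_sum_bnd.
exists [set h | exists n, U n h]; split.
  apply: absorbing_FK_nbhs0.
  - move=> h [n Uh]; apply: step_FK (Ubnd n h Uh); exact: ball_sum_smooth Uh.
  - move=> a b [m Ua] [n Ub] s t st; exists (maxn m n).
    apply: ball_sum_absconvex => //.
      exact: (ball_sum_mono w_gt0 rr_gt0 delta_gt0 (leq_maxl m n) Ua).
    exact: (ball_sum_mono w_gt0 rr_gt0 delta_gt0 (leq_maxr m n) Ub).
  - move=> n; exists (delta n) => // h sh hb; exists n.+1, (fun=> 0), h; split=> //.
    + exact: ball_sum0.
    + exact: (step_mono (leq_addl N n) (ltW (delta_gt0 n)) (lexx _) hb).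
    + by apply/funext => y; rewrite add0r.
  - by move=> a h [n Ua] sh nh; exists n.+1; exact: (ball_sum_null w_gt0 rr_gt0 delta_gt0 Ua).
have A0 : A (fun=> 0).
  have [e e0 He] := Aabs 0%N; apply: He; first exact: smooth_cst0.
  by apply: bnd_cst0; rewrite ?(ltW e0)//; exact: step_seq_ge0.
(* The term 2^-n b is the share of [A] not yet spent. Feeding the half sum of [b] and 2^(n+1) times
   the new increment to the induction hypothesis gives 2^-(n+1) b plus that increment. *)
have Inv n h : U n h -> forall b, A b ->
    A (fun y => 2^-1 ^+ n *: b y + fsub (f \o (fun y => g y + h y)) (f \o g) y).
  elim: n h => [h -> b Ab|n IH h [a [be [Ua sbe bbe ->]]] b Ab].
    rewrite (_ : (fun y => _) = b)//; apply/funext => y.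
    by rewrite /Defs.fsub /= addr0 subrr addr0 expr0 scale1r.
  have sa : smooth a := ball_sum_smooth Ua.
  pose g1 := fun y => g y + a y; pose g2 := fun y => g y + (a y + be y).
  have sg1 : smooth g1 := smooth_add sg sa.
  have sab : smooth (fun y => a y + be y) := smooth_add sa sbe.
  have sg2 : smooth g2 := smooth_add sg sab.
  have pw0 : 0 <= 1 - 2^-1 ^+ n :> R.
    by rewrite subr_ge0 exprn_ile1// invf_le1 ?ler1n.
  have b1 : step_bnd (N + n) K g1 G.
    apply: (step_mono (leqnn _) _ _ (bnd_add sg sa (bG n) (Ubnd _ _ Ua))).
      by rewrite addr_ge0.
    by rewrite lerD2l gerBl exprn_ge0.
  have b2 : step_bnd (N + n) K g2 G.
    apply: (step_mono (leqnn _) _ _ (bnd_add sg sab (bG n) (bnd_add sa sbe (Ubnd _ _ Ua) bbe))).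
      exact: (addr_ge0 G00 (addr_ge0 pw0 (ltW (delta_gt0 n)))).
    rewrite /G lerD2l; apply: le_trans (lerD (lexx _) (delta_le n)) _.
    rewrite exprS; have : 0 <= 2^-1 ^+ n :> R by rewrite exprn_ge0.
    lra.
  have b12 : step_bnd (N + n) K (fsub g2 g1) (d n).
    rewrite (_ : fsub g2 g1 = be).
      by apply: (step_mono (leqnn _) _ _ bbe) => //; exact: ltW.
    by apply/funext => y; apply/rowP => j; rewrite /Defs.fsub /g1 /g2 !mxE; ring.
  have AX := (Hd n).2 g1 g2 sg1 sg2 (fun x => bnd_norm (step_seq0 _) b1)
    (fun x => bnd_norm (step_seq0 _) b2) b1 b2 b12.
  have h2 : `|2^-1| + `|2^-1| <= 1 :> R by rewrite ger0_norm ?invr_ge0//; lra.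
  have := IH a Ua _ (Aconv _ _ Ab AX _ _ h2).
  congr A; apply/funext => y; rewrite /Defs.fsub /= -/(g1 y) -/(g2 y).
  apply/rowP => j; rewrite !mxE !exprS exprVn.
  by field; rewrite expf_neq0.
move=> g' sg' [n Un].
apply: AW; last exact: (smooth_fsub (smooth_comp sg' sf) (smooth_comp sg sf)).
have := Inv n _ Un _ A0; congr A; apply/funext => y; rewrite /Defs.fsub /=.
by rewrite scaler0 add0r [g y + _]addrC subrK.
Qed.

(** Both sequences converge within single steps by [ER_seq_step], so all estimates can be made in
    one common step [N]. *)
Lemma comp_seq_continuous (gs : nat -> 'rV[R]_p -> 'rV[R]_q)
    (fs : nat -> 'rV[R]_q -> 'rV[R]_r) g f K W :
  (forall n, ER Lam M p q (gs n)) -> (forall n, ER Lam M q r (fs n)) ->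
  ER Lam M p q g -> ER Lam M q r f ->
  (forall N, ER_nbhs Lam M p q g N -> exists n0, forall n, (n0 <= n)%N -> N (gs n)) ->
  (forall N, ER_nbhs Lam M q r f N -> exists n0, forall n, (n0 <= n)%N -> N (fs n)) ->
  compact K -> FK_nbhs0 Lam M p r K W ->
  exists n0, forall n, (n0 <= n)%N -> W (fsub (fs n \o gs n) (f \o g)).
Proof.
move=> Egs Efs [sg Fg] [sf Ff] cg cf cK /FK_nbhs0_absorbing[A [_ Aabs AW]].
have [ng [G0 G00 HG]] := FK_step (Fg K cK).
pose G := G0 + 1.
have G1 : 1 <= G by rewrite lerDr.
have Gp : 0 <= G by exact: le_trans G1.
have [nf [F F0 HF]] := FK_step (Ff _ (@compact_cball R q (G + 1))).
have [ig Hig] := ER_seq_step cK cg.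
have [jf Hif] := ER_seq_step (@compact_cball R q G) cf.
pose N := maxn (maxn ng nf) (maxn ig jf).
have [ngN nfN igN ifN] : [/\ ng <= N, nf <= N, ig <= N & jf <= N]%N.
  by split; rewrite /N !leq_max leqnn ?orbT.
have bG := HG N ngN; have bF := HF N nfN.
have N0 : 0 <= N.+1%:R :> R by rewrite ler0n.
pose rho : R := N.+1%:R * (2 + 4 * N.+1%:R * G).
have rho0 : 0 <= rho by rewrite mulr_ge0// addr_ge0// !mulr_ge0.
have [n' [B [B0 HB]]] := circ_step N rho0.
have [e e0 He] := Aabs n'.
pose e' := e / (2 * B).
have e'0 : 0 < e' by rewrite divr_gt0// mulr_gt0.
have [d d0 Hd] := comp_diff_small K (step_seq0 N) (step_seq_gt0 N) (ltr0Sn R N) N0 F0 G1 e'0 sf bF.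
have m0 : 0 < Num.min d 1 by rewrite lt_min d0 ltr01.
have [n1 Hn1] := Hig _ m0; have [n2 Hn2] := Hif _ e'0.
exists (maxn n1 n2) => n; rewrite geq_max => /andP[n1n n2n].
have sgn : smooth (gs n) := (Egs n).1; have sfn : smooth (fs n) := (Efs n).1.
have sdf : smooth (fsub (fs n) f) := smooth_fsub sfn sf.
have bdg : step_bnd N K (fsub (gs n) g) (Num.min d 1).
  exact: (step_mono igN (ltW m0) (lexx _) (Hn1 n n1n)).
have bdf : step_bnd N (cball G) (fsub (fs n) f) e'.
  exact: (step_mono ifN (ltW e'0) (lexx _) (Hn2 n n2n)).
have bgG : step_bnd N K g G by apply: (step_mono (leqnn _) G00 _ bG); rewrite /G lerDl.
have bgn : step_bnd N K (gs n) G.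
  rewrite (_ : gs n = (fun y => g y + fsub (gs n) g y)); last first.
    by apply/funext => y; rewrite /Defs.fsub addrC subrK.
  apply: (step_mono (leqnn _) _ _ (bnd_add sg (smooth_fsub sgn sg) bG bdg)).
    by rewrite addr_ge0 ?(ltW m0).
  by rewrite /G lerD2l ge_min lexx orbT.
have Kg x : K x -> `|g x| <= G by exact: (bnd_norm (step_seq0 N) bgG).
have Kgn x : K x -> `|gs n x| <= G by exact: (bnd_norm (step_seq0 N) bgn).
have bdg' : step_bnd N K (fsub (gs n) g) d.
  by apply: (step_mono (leqnn _) (ltW m0) _ bdg); rewrite ge_min lexx.
have H2 := HB _ _ _ _ _ (ltW e'0) (Hd g (gs n) sg sgn Kg Kgn bgG bgn bdg').
have H1 : step_bnd n' K (fsub (fs n) f \o gs n) (e' * B).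
  apply: HB; first exact: ltW.
  have := comp_bnd (L := cball G) (step_seq0 N) (step_seq_gt0 N) N0 N0
    (ltW e'0) Gp sdf sgn Kgn bdf bgn.
  apply: bnd_mono => //; rewrite ?(ltW e'0)//.
  - by rewrite mulr_ge0// addr_ge0// mulr_ge0.
  (* The radius from [comp_bnd] is below [rho], so the same [n'] and [B] serve both summands. *)
  - by rewrite /rho ler_wpM2l// lerD2l ler_wpM2r// ler_peMl// ler1n.
  - by move=> k; exact: circ_ge0.
have s1 : smooth (fsub (fs n) f \o gs n) := smooth_comp sgn sdf.
have s2 : smooth (fsub (f \o gs n) (f \o g)) :=
  smooth_fsub (smooth_comp sgn sf) (smooth_comp sg sf).
rewrite fsub_comp_split; apply: AW; last exact: (smooth_add s1 s2).
apply: He; first exact: (smooth_add s1 s2).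
have -> : e = e' * B + e' * B by rewrite /e'; field; rewrite gt_eqF.
exact: (bnd_add s1 s2 H1 H2).
Qed.

End Composition.

End Roumieu.

Section RoumieuTheorem.
Variables (R : realType) (Lam : set R) (M : R -> nat -> R) (p q r : nat).
Hypotheses (wM : weight_matrix Lam M) (fdb : FdB_roumieu Lam M).

(** The index set is nonempty as soon as the space has an element; this starts the cofinal
    sequence. *)
Lemma ER_Lam a b (h : 'rV[R]_a -> 'rV[R]_b) : ER Lam M a b h -> exists l, Lam l.
Proof.
by case=> _ /(_ _ (@compact_cball R a 0))[_ [l [m [Ll _]]]]; exists l.
Qed.

Lemma ER_comp_left_continuous (f : 'rV[R]_q -> 'rV[R]_r) (g : 'rV[R]_p -> 'rV[R]_q) :
  ER Lam M q r f -> ER Lam M p q g ->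
  ER Lam M p r (f \o g) /\
  forall N, ER_nbhs Lam M p r (f \o g) N ->
    exists N1, ER_nbhs Lam M p q g N1 /\
      forall g', ER Lam M p q g' -> N1 g' -> N (f \o g').
Proof.
move=> Ef Eg; have [l /cofinal_sequence[u [Lu u_mono u_cof]]] := ER_Lam Ef.
split=> [|N [n [Ks [Ws [cKs HWs HN]]]]].
  exact: (ER_comp wM fdb Lu u_mono u_cof Ef Eg).
have H i := comp_left_continuous wM fdb Lu u_mono u_cof Ef Eg (cKs i) (HWs i).
have [Vs HVs] := choice H.
exists [set h | forall i, Vs i (fsub h g)]; split.
  by exists n, Ks, Vs; split=> // i; exact: (HVs i).1.
move=> g' Eg' Hg'; apply: HN => [|i].
  exact: (ER_comp wM fdb Lu u_mono u_cof Ef Eg').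
by apply: (HVs i).2; [exact: Eg'.1|exact: Hg'].
Qed.

Lemma ER_comp_seq_continuous (gs : nat -> 'rV[R]_p -> 'rV[R]_q)
    (fs : nat -> 'rV[R]_q -> 'rV[R]_r) g f :
  (forall n, ER Lam M p q (gs n)) -> (forall n, ER Lam M q r (fs n)) ->
  ER Lam M p q g -> ER Lam M q r f ->
  (forall N, ER_nbhs Lam M p q g N -> exists n0, forall n, (n0 <= n)%N -> N (gs n)) ->
  (forall N, ER_nbhs Lam M q r f N -> exists n0, forall n, (n0 <= n)%N -> N (fs n)) ->
  forall N, ER_nbhs Lam M p r (f \o g) N ->
    exists n0, forall n, (n0 <= n)%N -> N (fs n \o gs n).
Proof.
move=> Egs Efs Eg Ef cg cf N [n [Ks [Ws [cKs HWs HN]]]].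
have [l /cofinal_sequence[u [Lu u_mono u_cof]]] := ER_Lam Ef.
have H i := comp_seq_continuous wM fdb Lu u_mono u_cof Egs Efs Eg Ef cg cf (cKs i) (HWs i).
have [n0 Hn0] := choice H.
exists (\max_i n0 i)%N => k nk; apply: HN => [|i].
  exact: (ER_comp wM fdb Lu u_mono u_cof (Efs k) (Egs k)).
by apply: Hn0; apply: leq_trans nk; exact: leq_bigmax.
Qed.

End RoumieuTheorem.

Theorem theorem4p13 (R : realType) (Lam : set R) (M : R -> nat -> R)
    (p q r : nat) :
  weight_matrix Lam M -> (0 < p)%N -> (0 < q)%N -> (0 < r)%N ->
  (* (1) Beurling case: comp is continuous on the product *)
  (FdB_beurling Lam M ->
    forall (g : vec R p -> vec R q) (f : vec R q -> vec R r),
      EB Lam M p q g -> EB Lam M q r f ->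
      EB Lam M p r (f \o g) /\
      forall N, EB_nbhs Lam M p r (f \o g) N ->
        exists N1 N2, [/\ EB_nbhs Lam M p q g N1, EB_nbhs Lam M q r f N2 &
          forall g' f', EB Lam M p q g' -> EB Lam M q r f' ->
            N1 g' -> N2 f' -> N (f' \o g')]) /\
  (* (2) Roumieu case *)
  (FdB_roumieu Lam M ->
    (* g |-> f o g is continuous for each fixed f *)
    (forall (f : vec R q -> vec R r) (g : vec R p -> vec R q),
       ER Lam M q r f -> ER Lam M p q g ->
       ER Lam M p r (f \o g) /\
       forall N, ER_nbhs Lam M p r (f \o g) N ->
         exists N1, ER_nbhs Lam M p q g N1 /\
           forall g', ER Lam M p q g' -> N1 g' -> N (f \o g')) /\
    (* comp is sequentially continuous on the product *)
    (forall (gs : nat -> vec R p -> vec R q) (fs : nat -> vec R q -> vec R r)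
            (g : vec R p -> vec R q) (f : vec R q -> vec R r),
       (forall n, ER Lam M p q (gs n)) -> (forall n, ER Lam M q r (fs n)) ->
       ER Lam M p q g -> ER Lam M q r f ->
       (forall N, ER_nbhs Lam M p q g N ->
          exists n0, forall n, (n0 <= n)%N -> N (gs n)) ->
       (forall N, ER_nbhs Lam M q r f N ->
          exists n0, forall n, (n0 <= n)%N -> N (fs n)) ->
       forall N, ER_nbhs Lam M p r (f \o g) N ->
         exists n0, forall n, (n0 <= n)%N -> N (fs n \o gs n))).
Proof.
move=> wM _ _ _; split=> [fdb g f Eg Ef|fdb]; split.
- exact: (EB_comp wM fdb Eg Ef).
- by move=> N; exact: (EB_comp_continuous wM fdb Eg Ef).
- by move=> f g; exact: ER_comp_left_continuous.
- by move=> gs fs g f; exact: ER_comp_seq_continuous.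
Qed.
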